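(* Let $\mathfrak h=\big((B_1,\mathrm m_1,\eta_1,\Delta_1,\varepsilon_1),(B_2,\mathrm m_2,\eta_2,\Delta_2,\varepsilon_2);\mu_l,\mu_r,\nu_l,\nu_r,\rho,\sigma\big)$ be a strong Hopf datum in $\mathcal C$. Then $B_1\otimes B_2$, with the morphisms $$\varphi_{1,2}=(\mathrm m_2\otimes\mathrm m_1)(\mathrm{id}_{B_2}\otimes\Psi_{B_1,B_2}\otimes\mathrm{id}_{B_1})(\nu_l\otimes\nu_r),\qquad \varphi_{2,1}=(\mu_l\otimes\mu_r)(\mathrm{id}_{B_2}\otimes\Psi_{B_2,B_1}\otimes\mathrm{id}_{B_1})(\Delta_2\otimes\Delta_1),$$ $$\hat\sigma=(\sigma\otimes\mathrm m_2(\mu_r\otimes\mathrm{id}_{B_2}))(\mathrm{id}_{B_2}\otimes\Psi_{B_2,B_2}\otimes\mathrm{id}_{B_1\otimes B_2})(\Delta_2\otimes(\nu_r\otimes\mathrm{id}_{B_2})\Delta_2),$$ $$\hat\rho=(\mathrm m_1(\mathrm{id}_{B_1}\otimes\mu_l)\otimes\mathrm m_1)(\mathrm{id}_{B_1\otimes B_2}\otimes\Psi_{B_1,B_1}\otimes\mathrm{id}_{B_1})((\mathrm{id}_{B_1}\otimes\nu_l)\Delta_1\otimes\rho),$$ is a strong cross product bialgebra, denoted $B_1\overset{\mathfrak h}{\bowtie}B_2$. Moreover, strong Hopf data and strong cross product bialgebras (the latter taken together with their complete collection of structure morphisms) are in one-to-one correspondence: $\mathfrak h\mapsto B_1\overset{\mathfrak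 h}{\bowtie}B_2$, with inverse sending a strong cross product bialgebra to the tuple of its structure morphisms.
   Context: $\mathcal C$ is a strict braided monoidal category with tensor product $\otimes$, unit object $\mathbb 1$ and braiding $\Psi$, in which idempotents split. Algebras, coalgebras, bialgebras, modules and comodules are taken in $\mathcal C$. Juxtaposition denotes composition; $\mathrm{id}$ without index is the identity of the object determined by the types. (A) Cross product algebra: let $(B_1,\mathrm m_1,\eta_1)$ be an algebra, $B_2$ an object, and $\eta_2:\mathbb 1\to B_2$, $\varphi_{2,1}:B_2\otimes B_1\to B_1\otimes B_2$, $\hat\sigma:B_2\otimes B_2\to B_1\otimes B_2$ morphisms with $\varphi_{2,1}=(\mathrm m_1\otimes\mathrm{id})(\mathrm{id}\otimes\hat\sigma)(\varphi_{2,1}\otimes\eta_2)$. If $B_1\otimes B_2$ is an algebra with multiplication $(\mathrm m_1\otimes\mathrm{id}_{B_2})(\mathrm m_1\otimes\hat\sigma)(\mathrm{id}_{B_1}\otimes\varphi_{2,1}\otimes\mathrm{id}_{B_2})$ and unit $\eta_1\otimes\eta_2$, it is a cross product algebra. Cross product coalgebra: let $(B_2,\Delta_2,\varepsilon_2)$ be a coalgebra, $B_1$ an object, and $\varepsilon_1:B_1\to\mathbb 1$, $\varphi_{1,2}:B_1\otimes B_2\to B_2\otimes B_1$, $\hat\rho:B_1\otimes B_2\to B_1\otimes B_1$ morphisms with $\varphi_{1,2}=(\varepsilon_1\otimes\varphi_{1,2})(\hat\rho\otimes\mathrm{id})(\mathrm{id}\otimes\Delta_2)$. If $B_1\otimes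 B_2$ is a coalgebra with comultiplication $(\mathrm{id}_{B_1}\otimes\varphi_{1,2}\otimes\mathrm{id}_{B_2})(\hat\rho\otimes\Delta_2)(\mathrm{id}_{B_1}\otimes\Delta_2)$ and counit $\varepsilon_1\otimes\varepsilon_2$, it is a cross product coalgebra. Cross product bialgebra: a bialgebra whose algebra is a cross product algebra and whose coalgebra is a cross product coalgebra on the same objects $B_1,B_2$; normalized if $\varepsilon_1\eta_1=\mathrm{id}_{\mathbb 1}$ (equivalently $\varepsilon_2\eta_2=\mathrm{id}_{\mathbb 1}$). (B) Structure morphisms. Besides $\mathrm m_1:B_1\otimes B_1\to B_1$, $\eta_1:\mathbb 1\to B_1$, $\varepsilon_1:B_1\to\mathbb 1$, $\Delta_2:B_2\to B_2\otimes B_2$, $\eta_2:\mathbb 1\to B_2$, $\varepsilon_2:B_2\to\mathbb 1$, consider $\Delta_1:B_1\to B_1\otimes B_1$, $\mathrm m_2:B_2\otimes B_2\to B_2$, $\mu_l:B_2\otimes B_1\to B_1$, $\mu_r:B_2\otimes B_1\to B_2$, $\nu_l:B_1\to B_2\otimes B_1$, $\nu_r:B_2\to B_2\otimes B_1$, $\sigma:B_2\otimes B_2\to B_1$, $\rho:B_2\to B_1\otimes B_1$. Put $\alpha=\mathrm m_2(\mu_r\otimes\mathrm{id}_{B_2})$, $\beta=(\nu_r\otimes\mathrm{id}_{B_2})\Delta_2$, $\lambda=\mathrm m_1(\mathrm{id}_{B_1}\otimes\mu_l)$, $\zeta=(\mathrm{id}_{B_1}\otimes\nu_l)\Delta_1$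 and $$\varphi_{1,2}=(\mathrm m_2\otimes\mathrm m_1)(\mathrm{id}_{B_2}\otimes\Psi_{B_1,B_2}\otimes\mathrm{id}_{B_1})(\nu_l\otimes\nu_r),\quad \varphi_{2,1}=(\mu_l\otimes\mu_r)(\mathrm{id}_{B_2}\otimes\Psi_{B_2,B_1}\otimes\mathrm{id}_{B_1})(\Delta_2\otimes\Delta_1),$$ $$\hat\sigma=(\sigma\otimes\alpha)(\mathrm{id}_{B_2}\otimes\Psi_{B_2,B_2}\otimes\mathrm{id}_{B_1\otimes B_2})(\Delta_2\otimes\beta),\quad \hat\rho=(\lambda\otimes\mathrm m_1)(\mathrm{id}_{B_1\otimes B_2}\otimes\Psi_{B_1,B_1}\otimes\mathrm{id}_{B_1})(\zeta\otimes\rho).\qquad( * )$$ Further put $\kappa=\mathrm m_1(\mathrm m_1\otimes\sigma)(\mathrm{id}_{B_1}\otimes\varphi_{2,1}\otimes\mathrm{id}_{B_2}):B_1\otimes B_2\otimes B_1\otimes B_2\to B_1$, $\omega=(\mathrm{id}_{B_1}\otimes\varphi_{1,2}\otimes\mathrm{id}_{B_2})(\rho\otimes\Delta_2)\Delta_2:B_2\to B_1\otimes B_2\otimes B_1\otimes B_2$, $\Theta=\Psi_{B_1\otimes B_2,\,B_1\otimes B_2}$. (C) Cocycle cross product bialgebra: a normalized cross product bialgebra together with morphisms $\Delta_1,\mathrm m_2,\mu_l,\mu_r,\nu_l,\nu_r,\sigma,\rho$ such that its $\varphi_{1,2},\varphi_{2,1},\hat\sigma,\hat\rho$ are given by $(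 * )$, the (co)unital identities (U1) $\Delta_1\eta_1=\eta_1\otimes\eta_1$, $(\mathrm{id}\otimes\varepsilon_1)\Delta_1=(\varepsilon_1\otimes\mathrm{id})\Delta_1=\mathrm{id}_{B_1}$, $\varepsilon_2\mathrm m_2=\varepsilon_2\otimes\varepsilon_2$, $\mathrm m_2(\mathrm{id}\otimes\eta_2)=\mathrm m_2(\eta_2\otimes\mathrm{id})=\mathrm{id}_{B_2}$; (U2) $\mu_r(\eta_2\otimes\mathrm{id})=\eta_2\varepsilon_1$, $\varepsilon_2\mu_r=\varepsilon_2\otimes\varepsilon_1$, $(\mathrm{id}\otimes\varepsilon_1)\nu_l=\eta_2\varepsilon_1$, $\nu_l\eta_1=\eta_2\otimes\eta_1$, $\mu_l(\eta_2\otimes\mathrm{id})=\mathrm{id}_{B_1}$, $\mu_l(\mathrm{id}\otimes\eta_1)=\eta_1\varepsilon_2$, $\varepsilon_1\mu_l=\varepsilon_2\otimes\varepsilon_1$, $(\mathrm{id}\otimes\varepsilon_1)\nu_r=\mathrm{id}_{B_2}$, $(\varepsilon_2\otimes\mathrm{id})\nu_r=\eta_1\varepsilon_2$, $\nu_r\eta_2=\eta_2\otimes\eta_1$; (U3) $\mu_r(\mathrm{id}\otimes\eta_1)=\mathrm{id}_{B_2}$, $(\varepsilon_2\otimes\mathrm{id})\nu_l=\mathrm{id}_{B_1}$ hold, and $$(\mathrm m_2\otimes\mathrm{id})(\mathrm{id}\otimes\nu_r)=(\mathrm m_2\otimes\mathrm{id})(\mu_r\otimes\varphi_{1,2})(\mathrm{id}\otimes(\rho\otimes\mathrm{id})\Delta_2),$$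 $$(\mu_l\otimes\mathrm{id})(\mathrm{id}\otimes\Delta_1)=(\mathrm m_1(\mathrm{id}\otimes\sigma)\otimes\mathrm{id})(\varphi_{2,1}\otimes\nu_l)(\mathrm{id}\otimes\Delta_1).$$ (D) Hopf datum: a tuple $\big((B_1,\mathrm m_1,\eta_1,\Delta_1,\varepsilon_1),(B_2,\mathrm m_2,\eta_2,\Delta_2,\varepsilon_2);\mu_l,\mu_r,\nu_l,\nu_r,\rho,\sigma\big)$ of objects and morphisms of the types in (B) such that: 1. $(B_1,\mathrm m_1,\eta_1)$ is an algebra and $\varepsilon_1$ an algebra morphism; 2. $(B_2,\Delta_2,\varepsilon_2)$ is a coalgebra and $\eta_2$ a coalgebra morphism; 3. $(B_1,\nu_l)$ is a left $B_2$-comodule; 4. $(B_2,\mu_r)$ is a right $B_1$-module; 5. (U1) and (U2) hold, and $\sigma(\eta_2\otimes\mathrm{id})=\sigma(\mathrm{id}\otimes\eta_2)=\eta_1\varepsilon_2$, $\varepsilon_1\sigma=\varepsilon_2\otimes\varepsilon_2$, $(\mathrm{id}\otimes\varepsilon_1)\rho=(\varepsilon_1\otimes\mathrm{id})\rho=\eta_1\varepsilon_2$, $\rho\eta_2=\eta_1\otimes\eta_1$; 6. with $\varphi_{1,2},\varphi_{2,1},\hat\sigma,\hat\rho$ defined by $( * )$, the following compatibilities hold: - weak (co)associativity of $\mathrm m_2$, $\Delta_1$: $\mathrm m_2(\mathrm m_2\otimes\mathrm{id})=\mathrm m_2(\mu_r\otimes\mathrm{id})(\mathrm{id}\otimes\hat\sigma)$;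 $(\mathrm{id}\otimes\Delta_1)\Delta_1=(\hat\rho\otimes\mathrm{id})(\mathrm{id}\otimes\nu_l)\Delta_1$; - weak (co)associativity of $\mu_l$, $\nu_r$: $\mathrm m_1(\mathrm{id}\otimes\mu_l)(\hat\sigma\otimes\mathrm{id})=\mathrm m_1(\mathrm{id}\otimes\sigma)(\varphi_{2,1}\otimes\mathrm{id})(\mathrm{id}\otimes\varphi_{2,1})$; $(\mathrm{id}\otimes\hat\rho)(\nu_r\otimes\mathrm{id})\Delta_2=(\varphi_{1,2}\otimes\mathrm{id})(\mathrm{id}\otimes\varphi_{1,2})(\rho\otimes\mathrm{id})\Delta_2$; - module-algebra: $\mu_l(\mathrm{id}\otimes\mathrm m_1)=\mathrm m_1(\mathrm{id}\otimes\mu_l)(\varphi_{2,1}\otimes\mathrm{id})$; $\mu_r(\mathrm m_2\otimes\mathrm{id})=\mathrm m_2(\mu_r\otimes\mathrm{id})(\mathrm{id}\otimes\varphi_{2,1})$; - comodule-coalgebra: $(\mathrm{id}\otimes\Delta_1)\nu_l=(\varphi_{1,2}\otimes\mathrm{id})(\mathrm{id}\otimes\nu_l)\Delta_1$; $(\Delta_2\otimes\mathrm{id})\nu_r=(\mathrm{id}\otimes\varphi_{1,2})(\nu_r\otimes\mathrm{id})\Delta_2$; - cocycle and cycle: $\mathrm m_1(\mathrm{id}\otimes\sigma)(\hat\sigma\otimes\mathrm{id})=\mathrm m_1(\mathrm{id}\otimes\sigma)(\varphi_{2,1}\otimes\mathrm{id})(\mathrm{id}\otimes\hat\sigma)$;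 $(\mathrm{id}\otimes\hat\rho)(\rho\otimes\mathrm{id})\Delta_2=(\hat\rho\otimes\mathrm{id})(\mathrm{id}\otimes\varphi_{1,2})(\rho\otimes\mathrm{id})\Delta_2$; - algebra-coalgebra: $\Delta_1\mathrm m_1=(\lambda\otimes\mathrm m_1)(\mathrm{id}_{B_1\otimes B_2}\otimes\Psi_{B_1,B_1}\otimes\mathrm{id}_{B_1})(\zeta\otimes\Delta_1)$; $\Delta_2\mathrm m_2=(\mathrm m_2\otimes\alpha)(\mathrm{id}_{B_2}\otimes\Psi_{B_2,B_2}\otimes\mathrm{id}_{B_1\otimes B_2})(\Delta_2\otimes\beta)$; - module-coalgebra: $\hat\rho\,\varphi_{2,1}=(\kappa\otimes\lambda)(\mathrm{id}_{B_1\otimes B_2}\otimes\Theta\otimes\mathrm{id}_{B_1})(\omega\otimes\zeta)$; $\Delta_2\mu_r=(\alpha\otimes\mu_r)(\mathrm{id}_{B_2}\otimes\Psi_{B_2,B_1\otimes B_2}\otimes\mathrm{id}_{B_1})(\Delta_2\otimes\zeta)$; - comodule-algebra: $\nu_l\mathrm m_1=(\alpha\otimes\mathrm m_1)(\mathrm{id}_{B_2}\otimes\Psi_{B_1,B_1\otimes B_2}\otimes\mathrm{id}_{B_1})(\nu_l\otimes\zeta)$; $\varphi_{1,2}\hat\sigma=(\alpha\otimes\kappa)(\mathrm{id}_{B_2}\otimes\Theta\otimes\mathrm{id}_{B_1\otimes B_2})(\beta\otimes\omega)$; - module-comodule: $\varphi_{1,2}\varphi_{2,1}=(\alpha\otimes\lambda)(\mathrm{id}_{B_2}\otimes\Theta\otimes\mathrm{id}_{B_1})(\beta\otimes\zeta)$;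 - cycle-cocycle: $\hat\rho\hat\sigma=(\kappa\otimes\kappa)(\mathrm{id}_{B_1\otimes B_2}\otimes\Theta\otimes\mathrm{id}_{B_1\otimes B_2})(\omega\otimes\omega)$. (E) Strong conditions, for morphisms as in (B) (write $1$ for identities): (S1) $(\mu_r\otimes1)(1\otimes\Psi_{B_1,B_1})(\nu_l\otimes1)=\nu_l\otimes\varepsilon_1$ on $B_1\otimes B_1$; (S2) $(1\otimes\mu_r)(\Psi_{B_2,B_2}\otimes1)(1\otimes\nu_l)=\eta_2\otimes\mu_r$ on $B_2\otimes B_1$; (S3) $(\sigma\otimes1\otimes1)(1\otimes\Psi_{B_1,B_2}\otimes1)(\nu_r\otimes\Psi_{B_1,B_2})(\nu_l\otimes1)=\eta_1\otimes\eta_1\otimes\mathrm{id}_{B_1}\otimes\varepsilon_2$ on $B_1\otimes B_2$; (S4) $(1\otimes\mu_r)(\Psi_{B_2,B_1}\otimes\mu_l)(1\otimes\Psi_{B_2,B_1}\otimes1)(1\otimes1\otimes\rho)=\eta_1\otimes\mathrm{id}_{B_2}\otimes\varepsilon_2\otimes\varepsilon_2$ on $B_2\otimes B_2\otimes B_2$; (S5) $(\sigma\otimes1)(1\otimes\nu_l)=\eta_1\varepsilon_2\otimes\mathrm{id}_{B_1}$ on $B_2\otimes B_1$; (S6) $(\mu_r\otimes1)(1\otimes\rho)=\mathrm{id}_{B_2}\otimes\eta_1\varepsilon_2$ on $B_2\otimes B_2$; (S7) on $B_2\otimes B_1\otimes B_2$: $(1\otimes\mu_r(1\otimes\mu_l)\otimes1\otimes1)(1\otimes1\otimes1\otimes\Psi_{B_1,B_1}\otimes1)(\Psi_{B_2,B_1}\otimes\nu_l\otimes1\otimes1)\,\xi=(1\otimes\mu_r\otimes1\otimes1)(\Psi_{B_2,B_1}\otimes\Psi_{B_1,B_1}\otimes1)\,\xi$,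 where $\xi=(1\otimes\Psi_{B_1,B_1}\otimes1\otimes1)(1\otimes1\otimes\Delta_1\otimes1)(1\otimes1\otimes\rho)$; (S8) on $B_2\otimes B_2\otimes B_1\otimes B_2$: $\chi\,(1\otimes1\otimes\mu_r\otimes\Psi_{B_1,B_2})(1\otimes\Psi_{B_2,B_2}\otimes1\otimes1\otimes1)(1\otimes1\otimes\nu_r\otimes1\otimes1)(1\otimes1\otimes\nu_l\otimes1)=\chi\,(1\otimes\Psi_{B_2,B_2}\otimes\Psi_{B_1,B_2})(1\otimes1\otimes\nu_l\otimes1)$, where $\chi=(\sigma(1\otimes\mathrm m_2)\otimes1\otimes1)(1\otimes1\otimes\Psi_{B_2,B_2}\otimes1)$. A strong cross product bialgebra is a cocycle cross product bialgebra whose structure morphisms satisfy (S1)–(S8). A strong Hopf datum is a Hopf datum satisfying (S1)–(S8). *)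

(* Defs.v *)
From mathcomp Require Import ssreflect ssrfun ssrbool seq.

Set Implicit Arguments.
Unset Strict Implicit.
Unset Printing Implicit Defensive.

Record category := Category {
  Ob :> Type;
  Hom : Ob -> Ob -> Type;
  idm : forall A, Hom A A;
  compm : forall A B D, Hom B D -> Hom A B -> Hom A D;
  compmA : forall A B D E (f : Hom D E) (g : Hom B D) (k : Hom A B),
    compm f (compm g k) = compm (compm f g) k;
  comp1m : forall A B (f : Hom A B), compm (idm B) f = f;
  compm1 : forall A B (f : Hom A B), compm f (idm A) = f
}.

Arguments Hom {c} A B.
Arguments idm {c} A.
Arguments compm {c A B D} f g.

(* The associativity and unit laws of a strict tensor product are equations
   between objects; morphisms are transported along them. *)
Definition castm (C : category) (A A' B B' : C) (eA : A = A') (eB : B = B')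
    (f : Hom A B) : Hom A' B' :=
  match eA in _ = X, eB in _ = Y return Hom X Y with
  | erefl, erefl => f
  end.

Record strict_monoidal_category := StrictMonoidalCategory {
  smc_category :> category;
  unitO : smc_category;
  tens : smc_category -> smc_category -> smc_category;
  tensA : forall A B D, tens (tens A B) D = tens A (tens B D);
  tens1O : forall A, tens unitO A = A;
  tensO1 : forall A, tens A unitO = A;
  tensm : forall (A B A' B' : smc_category),
    Hom A B -> Hom A' B' -> Hom (tens A A') (tens B B');
  tensm_id : forall A B, tensm (idm A) (idm B) = idm (tens A B);
  tensm_comp : forall (A B D A' B' D' : smc_category)
      (f : Hom B D) (g : Hom A B) (f' : Hom B' D') (g' : Hom A' B'),
    tensm (compm f g) (compm f' g') = compm (tensm f f') (tensm g g');
  tensmA : forall (A1 B1 A2 B2 A3 B3 : smc_category)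
      (f1 : Hom A1 B1) (f2 : Hom A2 B2) (f3 : Hom A3 B3),
    castm (tensA A1 A2 A3) (tensA B1 B2 B3) (tensm (tensm f1 f2) f3)
    = tensm f1 (tensm f2 f3);
  tens1m : forall (A B : smc_category) (f : Hom A B),
    castm (tens1O A) (tens1O B) (tensm (idm unitO) f) = f;
  tensm1 : forall (A B : smc_category) (f : Hom A B),
    castm (tensO1 A) (tensO1 B) (tensm f (idm unitO)) = f
}.

Arguments unitO {s}.
Arguments tens {s} A B.
Arguments tensA {s} A B D.
Arguments tens1O {s} A.
Arguments tensO1 {s} A.
Arguments tensm {s A B A' B'} f g.

Record strict_braided_category := StrictBraidedCategory {
  sbc_monoidal :> strict_monoidal_category;
  braid : forall A B : sbc_monoidal, Hom (tens A B) (tens B A);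
  braid_iso : forall A B, exists g : Hom (tens B A) (tens A B),
    compm g (braid A B) = idm (tens A B) /\ compm (braid A B) g = idm (tens B A);
  braid_nat : forall (A A' B B' : sbc_monoidal) (f : Hom A A') (g : Hom B B'),
    compm (braid A' B') (tensm f g) = compm (tensm g f) (braid A B);
  braid_tensr : forall A B D,
    braid A (tens B D)
    = compm (castm erefl (esym (tensA B D A)) (tensm (idm B) (braid A D)))
            (castm (tensA A B D) (tensA B A D) (tensm (braid A B) (idm D)));
  braid_tensl : forall A B D,
    braid (tens A B) D
    = compm (castm erefl (tensA D A B) (tensm (braid A D) (idm B)))
            (castm (esym (tensA A B D)) (esym (tensA A D B))
                   (tensm (idm A) (braid B D)))
}.

Arguments braid {s} A B.

Definition idempotents_split (C : category) : Prop :=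
  forall (A : C) (e : Hom A A), compm e e = e ->
  exists (D : C) (p : Hom A D) (i : Hom D A),
    compm i p = e /\ compm p i = idm D.

Section Words.
Variable C : strict_braided_category.

(* A word [:: A1; ...; An] stands for A1 (x) ... (x) An; concatenation of
   concrete words computes, so the strictness casts are confined to [wtens],
   [wbraid] and to places where a tensor product is used as a single letter.
   [wval [::]] is the unit object and [wval [:: A]] is A. *)
Fixpoint wval (w : seq C) : C :=
  match w with
  | [::] => unitO
  | A :: w' => match w' with [::] => A | _ => tens A (wval w') end
  end.

Lemma wval_cons (A : C) (w : seq C) : tens A (wval w) = wval (A :: w).
Proof. by case: w => [|B w]; [exact: tensO1 | reflexivity]. Defined.

Lemma wval_cat (u v : seq C) : tens (wval u) (wval v) = wval (u ++ v).
Proof.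
elim: u => [|A [|B u] IHu]; first exact: tens1O.
  exact: wval_cons.
exact: etrans (tensA A (wval (B :: u)) (wval v)) (congr1 (tens A) IHu).
Defined.

Definition wHom (u v : seq C) : Type := Hom (wval u) (wval v).
Definition wid (u : seq C) : wHom u u := idm (wval u).
Definition wcomp (u v w : seq C) (f : wHom v w) (g : wHom u v) : wHom u w :=
  compm f g.
Definition wtens (u v u' v' : seq C) (f : wHom u v) (g : wHom u' v') :
    wHom (u ++ u') (v ++ v') :=
  castm (wval_cat u u') (wval_cat v v') (tensm f g).
Definition wbraid (u v : seq C) : wHom (u ++ v) (v ++ u) :=
  castm (wval_cat u v) (wval_cat v u) (braid (wval u) (wval v)).

End Words.

Declare Scope word_scope.
Delimit Scope word_scope with W.
Local Open Scope word_scope.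
Notation "u ~> v" := (wHom u v) (at level 69, no associativity) : type_scope.
Notation "f ∘ g" := (wcomp f g) (at level 40, left associativity) : word_scope.
Notation "f ⊗ g" := (wtens f g) (at level 45, right associativity) : word_scope.
Notation "'Ψ' u v" := (wbraid u v)
  (at level 10, u at level 9, v at level 9) : word_scope.

Section Algebra.
Variable C : strict_braided_category.
Implicit Types A M : C.

Definition is_algebra A (m : [:: A; A] ~> [:: A]) (η : [::] ~> [:: A]) : Prop :=
  [/\ m ∘ (m ⊗ wid [:: A]) = m ∘ (wid [:: A] ⊗ m),
      m ∘ (η ⊗ wid [:: A]) = wid [:: A]
    & m ∘ (wid [:: A] ⊗ η) = wid [:: A]].

Definition is_coalgebra A (Δ : [:: A] ~> [:: A; A]) (ε : [:: A] ~> [::]) : Prop :=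
  [/\ (Δ ⊗ wid [:: A]) ∘ Δ = (wid [:: A] ⊗ Δ) ∘ Δ,
      (ε ⊗ wid [:: A]) ∘ Δ = wid [:: A]
    & (wid [:: A] ⊗ ε) ∘ Δ = wid [:: A]].

(* algebra morphism from A to the unit object *)
Definition is_augmentation A (m : [:: A; A] ~> [:: A]) (η : [::] ~> [:: A])
    (ε : [:: A] ~> [::]) : Prop :=
  ε ∘ m = ε ⊗ ε /\ ε ∘ η = wid [::].

(* coalgebra morphism from the unit object to A *)
Definition is_coaugmentation A (Δ : [:: A] ~> [:: A; A]) (ε : [:: A] ~> [::])
    (η : [::] ~> [:: A]) : Prop :=
  Δ ∘ η = η ⊗ η /\ ε ∘ η = wid [::].

Definition is_bialgebra A (m : [:: A; A] ~> [:: A]) (η : [::] ~> [:: A])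
    (Δ : [:: A] ~> [:: A; A]) (ε : [:: A] ~> [::]) : Prop :=
  [/\ is_algebra m η, is_coalgebra Δ ε,
      Δ ∘ m = (m ⊗ m) ∘ (wid [:: A] ⊗ Ψ [:: A] [:: A] ⊗ wid [:: A]) ∘ (Δ ⊗ Δ),
      Δ ∘ η = η ⊗ η
    & is_augmentation m η ε].

Definition is_left_comodule A M (Δ : [:: A] ~> [:: A; A]) (ε : [:: A] ~> [::])
    (ν : [:: M] ~> [:: A; M]) : Prop :=
  (Δ ⊗ wid [:: M]) ∘ ν = (wid [:: A] ⊗ ν) ∘ ν /\
  (ε ⊗ wid [:: M]) ∘ ν = wid [:: M].

Definition is_right_module A M (m : [:: A; A] ~> [:: A]) (η : [::] ~> [:: A])
    (μ : [:: M; A] ~> [:: M]) : Prop :=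
  μ ∘ (μ ⊗ wid [:: A]) = μ ∘ (wid [:: M] ⊗ m) /\
  μ ∘ (wid [:: M] ⊗ η) = wid [:: M].

End Algebra.

Record structure_data (C : strict_braided_category) := StructureData {
  B1 : C;
  B2 : C;
  m1 : [:: B1; B1] ~> [:: B1];
  η1 : [::] ~> [:: B1];
  Δ1 : [:: B1] ~> [:: B1; B1];
  ε1 : [:: B1] ~> [::];
  m2 : [:: B2; B2] ~> [:: B2];
  η2 : [::] ~> [:: B2];
  Δ2 : [:: B2] ~> [:: B2; B2];
  ε2 : [:: B2] ~> [::];
  μl : [:: B2; B1] ~> [:: B1];
  μr : [:: B2; B1] ~> [:: B2];
  νl : [:: B1] ~> [:: B2; B1];
  νr : [:: B2] ~> [:: B2; B1];
  ρ : [:: B2] ~> [:: B1; B1];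
  σ : [:: B2; B2] ~> [:: B1]
}.

Section StructureTheory.
Variable C : strict_braided_category.
Variable h : structure_data C.

Local Notation B1 := (B1 h).
Local Notation B2 := (B2 h).
Local Notation m1 := (m1 h).
Local Notation η1 := (η1 h).
Local Notation Δ1 := (Δ1 h).
Local Notation ε1 := (ε1 h).
Local Notation m2 := (m2 h).
Local Notation η2 := (η2 h).
Local Notation Δ2 := (Δ2 h).
Local Notation ε2 := (ε2 h).
Local Notation μl := (μl h).
Local Notation μr := (μr h).
Local Notation νl := (νl h).
Local Notation νr := (νr h).
Local Notation ρ := (ρ h).
Local Notation σ := (σ h).

Local Notation id1 := (wid [:: B1]).
Local Notation id2 := (wid [:: B2]).
Local Notation id12 := (wid [:: B1; B2]).
Local Notation Ψ11 := (Ψ [:: B1] [:: B1]).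
Local Notation Ψ12 := (Ψ [:: B1] [:: B2]).
Local Notation Ψ21 := (Ψ [:: B2] [:: B1]).
Local Notation Ψ22 := (Ψ [:: B2] [:: B2]).
Local Notation Θ := (Ψ [:: B1; B2] [:: B1; B2]).

Definition α : [:: B2; B1; B2] ~> [:: B2] := m2 ∘ (μr ⊗ id2).
Definition β : [:: B2] ~> [:: B2; B1; B2] := (νr ⊗ id2) ∘ Δ2.
Definition λ : [:: B1; B2; B1] ~> [:: B1] := m1 ∘ (id1 ⊗ μl).
Definition ζ : [:: B1] ~> [:: B1; B2; B1] := (id1 ⊗ νl) ∘ Δ1.

Definition φ12 : [:: B1; B2] ~> [:: B2; B1] :=
  (m2 ⊗ m1) ∘ (id2 ⊗ Ψ12 ⊗ id1) ∘ (νl ⊗ νr).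
Definition φ21 : [:: B2; B1] ~> [:: B1; B2] :=
  (μl ⊗ μr) ∘ (id2 ⊗ Ψ21 ⊗ id1) ∘ (Δ2 ⊗ Δ1).
Definition σhat : [:: B2; B2] ~> [:: B1; B2] :=
  (σ ⊗ α) ∘ (id2 ⊗ Ψ22 ⊗ id12) ∘ (Δ2 ⊗ β).
Definition ρhat : [:: B1; B2] ~> [:: B1; B1] :=
  (λ ⊗ m1) ∘ (id12 ⊗ Ψ11 ⊗ id1) ∘ (ζ ⊗ ρ).

Definition κ : [:: B1; B2; B1; B2] ~> [:: B1] :=
  m1 ∘ (m1 ⊗ σ) ∘ (id1 ⊗ φ21 ⊗ id2).
Definition ω : [:: B2] ~> [:: B1; B2; B1; B2] :=
  (id1 ⊗ φ12 ⊗ id2) ∘ (ρ ⊗ Δ2) ∘ Δ2.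

Record unital_U1 : Prop := UnitalU1 {
  Δ1_η1 : Δ1 ∘ η1 = η1 ⊗ η1;
  Δ1_counitr : (id1 ⊗ ε1) ∘ Δ1 = id1;
  Δ1_counitl : (ε1 ⊗ id1) ∘ Δ1 = id1;
  ε2_m2 : ε2 ∘ m2 = ε2 ⊗ ε2;
  m2_unitr : m2 ∘ (id2 ⊗ η2) = id2;
  m2_unitl : m2 ∘ (η2 ⊗ id2) = id2
}.

Record unital_U2 : Prop := UnitalU2 {
  μr_η2 : μr ∘ (η2 ⊗ id1) = η2 ∘ ε1;
  ε2_μr : ε2 ∘ μr = ε2 ⊗ ε1;
  νl_ε1 : (id2 ⊗ ε1) ∘ νl = η2 ∘ ε1;
  νl_η1 : νl ∘ η1 = η2 ⊗ η1;
  μl_η2 : μl ∘ (η2 ⊗ id1) = id1;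
  μl_η1 : μl ∘ (id2 ⊗ η1) = η1 ∘ ε2;
  ε1_μl : ε1 ∘ μl = ε2 ⊗ ε1;
  νr_ε1 : (id2 ⊗ ε1) ∘ νr = id2;
  νr_ε2 : (ε2 ⊗ id1) ∘ νr = η1 ∘ ε2;
  νr_η2 : νr ∘ η2 = η2 ⊗ η1
}.

Record unital_U3 : Prop := UnitalU3 {
  μr_η1 : μr ∘ (id2 ⊗ η1) = id2;
  νl_ε2 : (ε2 ⊗ id1) ∘ νl = id1
}.

Record unital_σρ : Prop := UnitalSigmaRho {
  σ_unitl : σ ∘ (η2 ⊗ id2) = η1 ∘ ε2;
  σ_unitr : σ ∘ (id2 ⊗ η2) = η1 ∘ ε2;
  ε1_σ : ε1 ∘ σ = ε2 ⊗ ε2;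
  ρ_counitr : (id1 ⊗ ε1) ∘ ρ = η1 ∘ ε2;
  ρ_counitl : (ε1 ⊗ id1) ∘ ρ = η1 ∘ ε2;
  ρ_η2 : ρ ∘ η2 = η1 ⊗ η1
}.

Record hopf_compatibility : Prop := HopfCompatibility {
  weak_assoc_m2 : m2 ∘ (m2 ⊗ id2) = m2 ∘ (μr ⊗ id2) ∘ (id2 ⊗ σhat);
  weak_coassoc_Δ1 : (id1 ⊗ Δ1) ∘ Δ1 = (ρhat ⊗ id1) ∘ (id1 ⊗ νl) ∘ Δ1;
  weak_assoc_μl :
    m1 ∘ (id1 ⊗ μl) ∘ (σhat ⊗ id1)
    = m1 ∘ (id1 ⊗ σ) ∘ (φ21 ⊗ id2) ∘ (id2 ⊗ φ21);
  weak_coassoc_νr :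
    (id2 ⊗ ρhat) ∘ (νr ⊗ id2) ∘ Δ2
    = (φ12 ⊗ id1) ∘ (id1 ⊗ φ12) ∘ (ρ ⊗ id2) ∘ Δ2;
  module_algebra_μl : μl ∘ (id2 ⊗ m1) = m1 ∘ (id1 ⊗ μl) ∘ (φ21 ⊗ id1);
  module_algebra_μr : μr ∘ (m2 ⊗ id1) = m2 ∘ (μr ⊗ id2) ∘ (id2 ⊗ φ21);
  comodule_coalgebra_νl :
    (id2 ⊗ Δ1) ∘ νl = (φ12 ⊗ id1) ∘ (id1 ⊗ νl) ∘ Δ1;
  comodule_coalgebra_νr :
    (Δ2 ⊗ id1) ∘ νr = (id2 ⊗ φ12) ∘ (νr ⊗ id2) ∘ Δ2;
  cocycle_σ :
    m1 ∘ (id1 ⊗ σ) ∘ (σhat ⊗ id2)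
    = m1 ∘ (id1 ⊗ σ) ∘ (φ21 ⊗ id2) ∘ (id2 ⊗ σhat);
  cycle_ρ :
    (id1 ⊗ ρhat) ∘ (ρ ⊗ id2) ∘ Δ2
    = (ρhat ⊗ id1) ∘ (id1 ⊗ φ12) ∘ (ρ ⊗ id2) ∘ Δ2;
  algebra_coalgebra1 :
    Δ1 ∘ m1 = (λ ⊗ m1) ∘ (id12 ⊗ Ψ11 ⊗ id1) ∘ (ζ ⊗ Δ1);
  algebra_coalgebra2 :
    Δ2 ∘ m2 = (m2 ⊗ α) ∘ (id2 ⊗ Ψ22 ⊗ id12) ∘ (Δ2 ⊗ β);
  module_coalgebra1 :
    ρhat ∘ φ21 = (κ ⊗ λ) ∘ (id12 ⊗ Θ ⊗ id1) ∘ (ω ⊗ ζ);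
  module_coalgebra2 :
    Δ2 ∘ μr = (α ⊗ μr) ∘ (id2 ⊗ Ψ [:: B2] [:: B1; B2] ⊗ id1) ∘ (Δ2 ⊗ ζ);
  comodule_algebra1 :
    νl ∘ m1 = (α ⊗ m1) ∘ (id2 ⊗ Ψ [:: B1] [:: B1; B2] ⊗ id1) ∘ (νl ⊗ ζ);
  comodule_algebra2 :
    φ12 ∘ σhat = (α ⊗ κ) ∘ (id2 ⊗ Θ ⊗ id12) ∘ (β ⊗ ω);
  module_comodule :
    φ12 ∘ φ21 = (α ⊗ λ) ∘ (id2 ⊗ Θ ⊗ id1) ∘ (β ⊗ ζ);
  cycle_cocycle :
    ρhat ∘ σhat = (κ ⊗ κ) ∘ (id12 ⊗ Θ ⊗ id12) ∘ (ω ⊗ ω)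
}.

Record hopf_datum : Prop := HopfDatum {
  hd_algebra : is_algebra m1 η1;
  hd_augmentation : is_augmentation m1 η1 ε1;
  hd_coalgebra : is_coalgebra Δ2 ε2;
  hd_coaugmentation : is_coaugmentation Δ2 ε2 η2;
  hd_comodule : is_left_comodule Δ2 ε2 νl;
  hd_module : is_right_module m1 η1 μr;
  hd_U1 : unital_U1;
  hd_U2 : unital_U2;
  hd_σρ : unital_σρ;
  hd_compatibility : hopf_compatibility
}.

Definition ξ : [:: B2; B1; B2] ~> [:: B2; B1; B1; B1; B1] :=
  (id2 ⊗ Ψ11 ⊗ id1 ⊗ id1) ∘ (id2 ⊗ id1 ⊗ Δ1 ⊗ id1) ∘ (id2 ⊗ id1 ⊗ ρ).
Definition χ : [:: B2; B2; B2; B2; B1] ~> [:: B1; B2; B1] :=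
  (σ ∘ (id2 ⊗ m2) ⊗ id2 ⊗ id1) ∘ (id2 ⊗ id2 ⊗ Ψ22 ⊗ id1).

Record strong_conditions : Prop := StrongConditions {
  strong1 : (μr ⊗ id1) ∘ (id2 ⊗ Ψ11) ∘ (νl ⊗ id1) = νl ⊗ ε1;
  strong2 : (id2 ⊗ μr) ∘ (Ψ22 ⊗ id1) ∘ (id2 ⊗ νl) = η2 ⊗ μr;
  strong3 :
    (σ ⊗ id1 ⊗ id1) ∘ (id2 ⊗ Ψ12 ⊗ id1) ∘ (νr ⊗ Ψ12) ∘ (νl ⊗ id2)
    = η1 ⊗ η1 ⊗ id1 ⊗ ε2;
  strong4 :
    (id1 ⊗ μr) ∘ (Ψ21 ⊗ μl) ∘ (id2 ⊗ Ψ21 ⊗ id1) ∘ (id2 ⊗ id2 ⊗ ρ)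
    = η1 ⊗ id2 ⊗ ε2 ⊗ ε2;
  strong5 : (σ ⊗ id1) ∘ (id2 ⊗ νl) = η1 ∘ ε2 ⊗ id1;
  strong6 : (μr ⊗ id1) ∘ (id2 ⊗ ρ) = id2 ⊗ η1 ∘ ε2;
  strong7 :
    (id1 ⊗ μr ∘ (id2 ⊗ μl) ⊗ id1 ⊗ id1) ∘ (id1 ⊗ id2 ⊗ id2 ⊗ Ψ11 ⊗ id1)
      ∘ (Ψ21 ⊗ νl ⊗ id1 ⊗ id1) ∘ ξ
    = (id1 ⊗ μr ⊗ id1 ⊗ id1) ∘ (Ψ21 ⊗ Ψ11 ⊗ id1) ∘ ξ;
  strong8 :
    χ ∘ (id2 ⊗ id2 ⊗ μr ⊗ Ψ12) ∘ (id2 ⊗ Ψ22 ⊗ id1 ⊗ id1 ⊗ id2)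
      ∘ (id2 ⊗ id2 ⊗ νr ⊗ id1 ⊗ id2) ∘ (id2 ⊗ id2 ⊗ νl ⊗ id2)
    = χ ∘ (id2 ⊗ Ψ22 ⊗ Ψ12) ∘ (id2 ⊗ id2 ⊗ νl ⊗ id2)
}.

Record strong_hopf_datum : Prop := StrongHopfDatum {
  shd_hopf_datum : hopf_datum;
  shd_strong : strong_conditions
}.

End StructureTheory.

Definition B12 (C : strict_braided_category) (h : structure_data C) : C :=
  tens (B1 h) (B2 h).

(* A bialgebra on the object B1 (x) B2 (one letter) together with all the
   structure morphisms of a cocycle cross product bialgebra. *)
Record cross_product_data (C : strict_braided_category) := CrossProductData {
  cp_structure :> structure_data C;
  cp_φ12 : [:: B1 cp_structure; B2 cp_structure]
           ~> [:: B2 cp_structure; B1 cp_structure];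
  cp_φ21 : [:: B2 cp_structure; B1 cp_structure]
           ~> [:: B1 cp_structure; B2 cp_structure];
  cp_σhat : [:: B2 cp_structure; B2 cp_structure]
            ~> [:: B1 cp_structure; B2 cp_structure];
  cp_ρhat : [:: B1 cp_structure; B2 cp_structure]
            ~> [:: B1 cp_structure; B1 cp_structure];
  cp_m : [:: B12 cp_structure; B12 cp_structure] ~> [:: B12 cp_structure];
  cp_η : [::] ~> [:: B12 cp_structure];
  cp_Δ : [:: B12 cp_structure] ~> [:: B12 cp_structure; B12 cp_structure];
  cp_ε : [:: B12 cp_structure] ~> [::]
}.

Section Regroup.
Variables (C : strict_braided_category) (A B : C).

(* (A (x) B) (x) (A (x) B) = A (x) B (x) A (x) B *)
Definition group_dom (f : [:: A; B; A; B] ~> [:: A; B]) :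
    [:: tens A B; tens A B] ~> [:: tens A B] :=
  castm (esym (tensA A B (tens A B))) erefl f.
Definition group_cod (f : [:: A; B] ~> [:: A; B; A; B]) :
    [:: tens A B] ~> [:: tens A B; tens A B] :=
  castm erefl (esym (tensA A B (tens A B))) f.

End Regroup.

Section CrossProductFormulas.
Variables (C : strict_braided_category) (h : structure_data C).

Local Notation id1 := (wid [:: B1 h]).
Local Notation id2 := (wid [:: B2 h]).

Definition cross_mul (φ : [:: B2 h; B1 h] ~> [:: B1 h; B2 h])
    (s : [:: B2 h; B2 h] ~> [:: B1 h; B2 h]) :
    [:: B1 h; B2 h; B1 h; B2 h] ~> [:: B1 h; B2 h] :=
  (m1 h ⊗ id2) ∘ (m1 h ⊗ s) ∘ (id1 ⊗ φ ⊗ id2).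

Definition cross_comul (φ : [:: B1 h; B2 h] ~> [:: B2 h; B1 h])
    (r : [:: B1 h; B2 h] ~> [:: B1 h; B1 h]) :
    [:: B1 h; B2 h] ~> [:: B1 h; B2 h; B1 h; B2 h] :=
  (id1 ⊗ φ ⊗ id2) ∘ (r ⊗ Δ2 h) ∘ (id1 ⊗ Δ2 h).

Definition bowtie : cross_product_data C :=
  @CrossProductData C h (φ12 h) (φ21 h) (σhat h) (ρhat h)
    (group_dom (cross_mul (φ21 h) (σhat h))) (η1 h ⊗ η2 h)
    (group_cod (cross_comul (φ12 h) (ρhat h))) (ε1 h ⊗ ε2 h).

End CrossProductFormulas.

Section CrossProductBialgebra.
Variables (C : strict_braided_category) (X : cross_product_data C).

Local Notation id1 := (wid [:: B1 X]).
Local Notation id2 := (wid [:: B2 X]).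

Record cross_product_algebra : Prop := CrossProductAlgebra {
  cpa_algebra1 : is_algebra (m1 X) (η1 X);
  cpa_φ21 : cp_φ21 X = (m1 X ⊗ id2) ∘ (id1 ⊗ cp_σhat X) ∘ (cp_φ21 X ⊗ η2 X);
  cpa_mul : cp_m X = group_dom (cross_mul (cp_φ21 X) (cp_σhat X));
  cpa_unit : cp_η X = η1 X ⊗ η2 X;
  cpa_algebra : is_algebra (cp_m X) (cp_η X)
}.

Record cross_product_coalgebra : Prop := CrossProductCoalgebra {
  cpc_coalgebra2 : is_coalgebra (Δ2 X) (ε2 X);
  cpc_φ12 : cp_φ12 X = (ε1 X ⊗ cp_φ12 X) ∘ (cp_ρhat X ⊗ id2) ∘ (id1 ⊗ Δ2 X);
  cpc_comul : cp_Δ X = group_cod (cross_comul (cp_φ12 X) (cp_ρhat X));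
  cpc_counit : cp_ε X = ε1 X ⊗ ε2 X;
  cpc_coalgebra : is_coalgebra (cp_Δ X) (cp_ε X)
}.

Record cross_product_bialgebra : Prop := CrossProductBialgebra {
  cpb_algebra : cross_product_algebra;
  cpb_coalgebra : cross_product_coalgebra;
  cpb_bialgebra : is_bialgebra (cp_m X) (cp_η X) (cp_Δ X) (cp_ε X)
}.

Definition cp_normalized : Prop := ε1 X ∘ η1 X = wid [::].

Record cocycle_cross_product_bialgebra : Prop := CocycleCrossProductBialgebra {
  ccp_bialgebra : cross_product_bialgebra;
  ccp_normalized : cp_normalized;
  ccp_φ12 : cp_φ12 X = φ12 X;
  ccp_φ21 : cp_φ21 X = φ21 X;
  ccp_σhat : cp_σhat X = σhat X;
  ccp_ρhat : cp_ρhat X = ρhat X;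
  ccp_U1 : unital_U1 X;
  ccp_U2 : unital_U2 X;
  ccp_U3 : unital_U3 X;
  ccp_νr :
    (m2 X ⊗ id1) ∘ (id2 ⊗ νr X)
    = (m2 X ⊗ id1) ∘ (μr X ⊗ cp_φ12 X) ∘ (id2 ⊗ (ρ X ⊗ id2) ∘ Δ2 X);
  ccp_μl :
    (μl X ⊗ id1) ∘ (id2 ⊗ Δ1 X)
    = (m1 X ∘ (id1 ⊗ σ X) ⊗ id1) ∘ (cp_φ21 X ⊗ νl X) ∘ (id2 ⊗ Δ1 X)
}.

Record strong_cross_product_bialgebra : Prop := StrongCrossProductBialgebra {
  scp_cocycle : cocycle_cross_product_bialgebra;
  scp_strong : strong_conditions X
}.

End CrossProductBialgebra.

(* Main.v *)
From HB Require Import structures.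
From mathcomp Require Import ssreflect ssrfun ssrbool eqtype ssrnat seq.
From Stdlib Require Import ClassicalEpsilon Eqdep.
Require Import Defs.

Set Implicit Arguments.
Unset Strict Implicit.
Unset Printing Implicit Defensive.

(** A strong Hopf datum makes A = B1 (x) B2 a bialgebra because its product is
    governed by the right action α of A on B2.

    Through this action the datum looks much simpler than it is.  By the strong
    conditions νl and ρ become trivial when a strand of B1 coming from them acts
    on B2, so that ρhat is seen as Δ1 ([ρhat_act]) and the weak
    coassociativities as genuine ones ([Δ1_coassoc_act], [νr_coassoc_act],
    [ρ_coassoc_act]).  What the action sees of the coproduct of A is the map
    T : x (x) h |-> h1 (x) x.h2 from B2 (x) A to A (x) B2 ([Δ_act]).  It determines
    how B2 passes to the right of elements of A: the product of a (x) x and h is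
    κ(a (x) x1, h1) (x) x2.h2 ([m_T]).

    Associativity: T is multiplicative, that is, it respects the product of B1,
    φ21 and σhat ([T1_m1], [T_φ21], [T_σhat]).  Hence the law of associativity
    has to be checked after projection to B1 only, where it is an axiom of the
    datum ([φ21_m1], [σhat_φ21], [σhat_cocycle], and then [m_assoc]).

    Multiplicativity of the coproduct: A is generated by B1 and B2, and its
    coproduct sends a in B1 to ζ(a) and x in B2 to ω(x).  So it is enough that
    ζ is multiplicative, that the coproducts of φ21(x (x) a) and σhat(x (x) y)
    are ω(x) ζ(a) and ω(x) ω(y), and that the coproduct of a (x) x is
    ζ(a) ω(x).  These are the duals of [Δ2_α_Δ], of [φ12_m] and of [m_κα],
    together with [Δ_σhat]; [Δ_m] combines them.

    Conversely every compatibility of a Hopf datum is a component of associativity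
    or of multiplicativity of the coproduct of the bialgebra, or of a dual of
    these: restrict the inputs to B1 or B2 by η2 or η1 and project the outputs
    by ε2 or ε1.  Only the formula for
    Δ1 m1 and its dual need a strong condition in addition.

    Two devices keep the proof short.  First, the notions are invariant under
    turning string diagrams by half a turn while exchanging B1 and B2.  [holds]
    asserts an equation together with its dual, so that only one of two dual
    laws is ever proved.  Secondly, equations between composites are proved by
    reflection.  A composite is flattened to a list of layers; [replay] performs
    interchanges of layers, naturality of the braiding and known equations, and
    its correctness is [same_replay].  The moves are found by a search which
    needs no proof and which is guided by the list of equations to be
    used.  Strictness casts do not appear, because morphisms are packed with
    their source and target and composed partially. *)

(** * Boxes, expressions and layered diagrams *)

Inductive letter := L1 | L2.
Definition letter_eq (a b : letter) : bool :=
  match a, b with L1, L1 | L2, L2 => true | _, _ => false end.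
Lemma letter_eqP : Equality.axiom letter_eq.
Proof. by case; case; constructor. Qed.
HB.instance Definition _ := hasDecEq.Build letter letter_eqP.

(** The structure morphisms and the composites that get a name of their own.
    [bm] and [bΔ] are the product and coproduct of B1 (x) B2.  [bT1], [bT2],
    [bT] are explained at [T1_of] below; [bV1], [bV2], [bV] are their images
    under duality, so that duality permutes the boxes. *)
Inductive box :=
  | bm1 | bη1 | bΔ1 | bε1 | bm2 | bη2 | bΔ2 | bε2
  | bμl | bμr | bνl | bνr | bρ | bσ
  | bα | bβ | bλ | bζ | bφ12 | bφ21 | bσhat | bρhat | bκ | bω
  | bT1 | bT2 | bT | bV1 | bV2 | bV | bm | bΔ.
Scheme Equality for box.
Lemma box_eqP : Equality.axiom box_beq.
Proof.
move=> a b; apply: (iffP idP); first exact: internal_box_dec_bl.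
exact: internal_box_dec_lb.
Qed.
HB.instance Definition _ := hasDecEq.Build box box_eqP.

Definition word := seq letter.

Definition arity (b : box) : word * word :=
  match b with
  | bm1 => ([:: L1; L1], [:: L1]) | bη1 => ([::], [:: L1])
  | bΔ1 => ([:: L1], [:: L1; L1]) | bε1 => ([:: L1], [::])
  | bm2 => ([:: L2; L2], [:: L2]) | bη2 => ([::], [:: L2])
  | bΔ2 => ([:: L2], [:: L2; L2]) | bε2 => ([:: L2], [::])
  | bμl => ([:: L2; L1], [:: L1]) | bμr => ([:: L2; L1], [:: L2])
  | bνl => ([:: L1], [:: L2; L1]) | bνr => ([:: L2], [:: L2; L1])
  | bρ => ([:: L2], [:: L1; L1]) | bσ => ([:: L2; L2], [:: L1])
  | bα => ([:: L2; L1; L2], [:: L2]) | bβ => ([:: L2], [:: L2; L1; L2])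
  | bλ => ([:: L1; L2; L1], [:: L1]) | bζ => ([:: L1], [:: L1; L2; L1])
  | bφ12 => ([:: L1; L2], [:: L2; L1]) | bφ21 => ([:: L2; L1], [:: L1; L2])
  | bσhat => ([:: L2; L2], [:: L1; L2]) | bρhat => ([:: L1; L2], [:: L1; L1])
  | bκ => ([:: L1; L2; L1; L2], [:: L1]) | bω => ([:: L2], [:: L1; L2; L1; L2])
  | bT1 => ([:: L2; L1], [:: L1; L2]) | bT2 => ([:: L2; L2], [:: L2; L2])
  | bT => ([:: L2; L1; L2], [:: L1; L2; L2])
  | bV1 => ([:: L1; L2], [:: L2; L1]) | bV2 => ([:: L1; L1], [:: L1; L1])
  | bV => ([:: L1; L1; L2], [:: L1; L2; L1])
  | bm => ([:: L1; L2; L1; L2], [:: L1; L2])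
  | bΔ => ([:: L1; L2], [:: L1; L2; L1; L2])
  end.

(** Duality turns a diagram by half a turn and exchanges B1 with B2: a product
    on B1 becomes a coproduct on B2, a left action a right coaction, the cocycle
    σ the cycle ρ.  The axioms of a Hopf datum are stable under it. *)
Definition rot_letter a := match a with L1 => L2 | L2 => L1 end.
Definition rot_word (w : word) : word := rev (map rot_letter w).
Definition rot_box (b : box) : box :=
  match b with
  | bm1 => bΔ2 | bη1 => bε2 | bΔ1 => bm2 | bε1 => bη2
  | bm2 => bΔ1 | bη2 => bε1 | bΔ2 => bm1 | bε2 => bη1
  | bμl => bνr | bμr => bνl | bνl => bμr | bνr => bμl | bρ => bσ | bσ => bρ
  | bα => bζ | bβ => bλ | bλ => bβ | bζ => bα | bφ12 => bφ21 | bφ21 => bφ12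
  | bσhat => bρhat | bρhat => bσhat | bκ => bω | bω => bκ
  | bT1 => bV1 | bT2 => bV2 | bT => bV | bV1 => bT1 | bV2 => bT2 | bV => bT
  | bm => bΔ | bΔ => bm
  end.

Inductive gen := Gbox of box | Gcross of letter & letter.
Definition gen_eq (g k : gen) : bool :=
  match g, k with
  | Gbox b, Gbox c => b == c
  | Gcross a b, Gcross c d => (a == c) && (b == d)
  | _, _ => false
  end.
Lemma gen_eqP : Equality.axiom gen_eq.
Proof.
case=> [b|a b] [c|c d] /=; try by constructor.
  by apply: (iffP eqP) => [->|[->]].
by apply: (iffP andP) => [[/eqP-> /eqP->]|[-> ->]].
Qed.
HB.instance Definition _ := hasDecEq.Build gen gen_eqP.

Definition dom (g : gen) : word :=
  match g with Gbox b => (arity b).1 | Gcross a b => [:: a; b] end.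
Definition cod (g : gen) : word :=
  match g with Gbox b => (arity b).2 | Gcross a b => [:: b; a] end.
Definition rot_gen (g : gen) : gen :=
  match g with
  | Gbox b => Gbox (rot_box b)
  | Gcross a b => Gcross (rot_letter a) (rot_letter b)
  end.

(** A layer [(p, g, s)] is the generator [g] between the identity strands [p]
    and [s]; a diagram is a list of layers, read in the order in which they are
    composed. *)
Definition layer := (word * gen * word)%type.
Definition whisk (p s : word) (d : seq layer) : seq layer :=
  [seq (p ++ l.1.1, l.1.2, l.2 ++ s) | l <- d].
Definition rot_layer (l : layer) : layer :=
  (rot_word l.2, rot_gen l.1.2, rot_word l.1.1).
Definition rot_layers (d : seq layer) : seq layer := rev (map rot_layer d).

Fixpoint cross1 (a : letter) (v : word) : seq layer :=
  match v with
  | [::] => [::]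
  | b :: v' => ([::], Gcross a b, v') :: whisk [:: b] [::] (cross1 a v')
  end.
Fixpoint cross (u v : word) : seq layer :=
  match u with
  | [::] => [::]
  | a :: u' => whisk [:: a] [::] (cross u' v) ++ whisk [::] u' (cross1 a v)
  end.

Inductive expr :=
  | Box of box
  | Id of word
  | Cross of word & word
  | Comp of expr & expr
  | Tens of expr & expr.

Fixpoint src (e : expr) : word :=
  match e with
  | Box b => (arity b).1 | Id w => w | Cross u v => u ++ v
  | Comp _ f => src f | Tens f g => src f ++ src g
  end.
Fixpoint tgt (e : expr) : word :=
  match e with
  | Box b => (arity b).2 | Id w => w | Cross u v => v ++ u
  | Comp f _ => tgt f | Tens f g => tgt f ++ tgt g
  end.
Fixpoint typed (e : expr) : bool :=
  match e with
  | Comp f g => [&& typed f, typed g & src f == tgt g]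
  | Tens f g => typed f && typed g
  | _ => true
  end.
Fixpoint rot (e : expr) : expr :=
  match e with
  | Box b => Box (rot_box b) | Id w => Id (rot_word w)
  | Cross u v => Cross (rot_word u) (rot_word v)
  | Comp f g => Comp (rot g) (rot f) | Tens f g => Tens (rot g) (rot f)
  end.
Fixpoint layers (e : expr) : seq layer :=
  match e with
  | Box b => [:: ([::], Gbox b, [::])]
  | Id _ => [::]
  | Cross u v => cross u v
  | Comp f g => layers g ++ layers f
  | Tens f g => whisk [::] (src g) (layers f) ++ whisk (tgt f) [::] (layers g)
  end.

(** * Moves between diagrams *)

(** An equation between diagrams: the common source and the two sides. *)
Definition rule := (word * seq layer * seq layer)%type.

(** A rule is either one of a list of known equations or an instance of the
    naturality of the braiding: [Slide g c left flip] moves the generator [g]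
    through a strand [c] that crosses from its left or from its right. *)
Inductive reference := Known of nat | Slide of gen & letter & bool & bool.

(** [Swap k] interchanges the independent layers [k] and [k.+1];
    [Rewrite k n i] applies rule [i] at layer [k], with its leftmost strand at
    position [n]. *)
Inductive move := Swap of nat | Rewrite of nat & nat & reference.

Definition swap2 (l k : layer) : option (layer * layer) :=
  let: (p, g, s) := l in let: (p', g', s') := k in
  if size p' + size (dom g') <= size p then
    let q := drop (size p' + size (dom g')) p in
    if (p == p' ++ dom g' ++ q) && (s' == q ++ cod g ++ s) then
      Some ((p', g', q ++ dom g ++ s), (p' ++ cod g' ++ q, g, s)) else None
  else
    let q := drop (size p + size (cod g)) p' in
    if (p' == p ++ cod g ++ q) && (s == q ++ dom g' ++ s') then
      Some ((p ++ dom g ++ q, g', s'), (p, g, q ++ cod g' ++ s')) else None.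

Definition glayer (g : gen) : layer := ([::], g, [::]).
Definition slide (g : gen) (c : letter) (left flip : bool) : rule :=
  let: (w, a, b) :=
    if left then
      (c :: dom g, whisk [:: c] [::] [:: glayer g] ++ cross [:: c] (cod g),
         cross [:: c] (dom g) ++ whisk [::] [:: c] [:: glayer g])
    else
      (dom g ++ [:: c], whisk [::] [:: c] [:: glayer g] ++ cross (cod g) [:: c],
         cross (dom g) [:: c] ++ whisk [:: c] [::] [:: glayer g]) in
  if flip then (w, b, a) else (w, a, b).
Definition lookup (rs : seq rule) (i : reference) : rule :=
  match i with
  | Known n => nth ([::], [::], [::]) rs n
  | Slide g c l f => slide g c l f
  end.

Definition rewrite_front (r : rule) (n : nat) (w : word) (d : seq layer) :
    option (seq layer) :=
  let: (u, a, b) := r in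
  let p := take n w in let s := drop (n + size u) w in
  if (w == p ++ u ++ s) && (take (size a) d == whisk p s a) then
    Some (whisk p s b ++ drop (size a) d)
  else None.

Fixpoint replay1 (rs : seq rule) (m : move) (k : nat) (w : word) (d : seq layer) :
    option (seq layer) :=
  match k, d with
  | k'.+1, l :: d' =>
      omap (cons l) (replay1 rs m k' (l.1.1 ++ cod l.1.2 ++ l.2) d')
  | 0, _ =>
      match m with
      | Swap _ =>
          match d with
          | l1 :: l2 :: d' =>
              if swap2 l1 l2 is Some (x, y) then Some (x :: y :: d') else None
          | _ => None
          end
      | Rewrite _ n i => rewrite_front (lookup rs i) n w d
      end
  | _, [::] => None
  end.
Definition move_pos m := match m with Swap k => k | Rewrite k _ _ => k end.
Fixpoint replay (rs : seq rule) (ms : seq move) (w : word) (d : seq layer) :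
    option (seq layer) :=
  match ms with
  | [::] => Some d
  | m :: ms' => obind (replay rs ms' w) (replay1 rs m (move_pos m) w d)
  end.

(** * Search for the moves *)

(** The functions of this module only propose moves, which [replay] checks;
    nothing is proved about them.  Since words are determined by the boxes, a
    layer is reduced here to the position and the name of its generator. *)
Module Find.
Definition lay := (nat * gen)%type.
Definition flat (d : seq layer) : seq lay := [seq (size l.1.1, l.1.2) | l <- d].
Notation nd g := (size (dom g)).
Notation nc g := (size (cod g)).

Definition exch (a b : lay) : option (lay * lay) :=
  let: (i, g) := a in let: (j, k) := b in
  if j + nd k <= i then Some ((j, k), (i + nc k - nd k, g))
  else if i + nc g <= j then Some ((j - nc g + nd g, k), (i, g))
  else None.

(** Pulls the layer with tag [t] to the front by interchanges, and counts
    them. *)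
Fixpoint pull (t : nat) (d : seq (nat * lay)) :
    option ((nat * lay) * seq (nat * lay) * nat) :=
  match d with
  | [::] => None
  | x :: d' =>
      if x.1 == t then Some (x, d', 0) else
      if pull t d' is Some (y, d'', c) then
        if exch x.2 y.2 is Some (y', x') then
          Some ((y.1, y'), (x.1, x') :: d'', c.+1)
        else None
      else None
  end.
Fixpoint swaps (pos c : nat) : seq move :=
  if c is c'.+1 then Swap (pos + c') :: swaps pos c' else [::].

Fixpoint reorder (order : seq nat) (pos : nat) (d : seq (nat * lay)) :
    option (seq lay * seq move) :=
  match order with
  | [::] => Some ([::], [::])
  | t :: order' =>
      if pull t d is Some (x, d', c) then
        if reorder order' pos.+1 d' is Some (l, ms) then
          Some (x.2 :: l, swaps pos c ++ ms) else None
      else None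
  end.
Definition tag (d : seq lay) := zip (iota 0 (size d)) d.

(** The diagram as a graph: a node is a generator with the names of its input
    and output wires.  Patterns are matched on graphs, so that a match does not
    depend on the order of independent layers. *)
Definition node := (gen * seq nat * seq nat)%type.
Fixpoint nodes (w : seq nat) (nxt : nat) (d : seq lay) : seq node :=
  match d with
  | [::] => [::]
  | (n, g) :: d' =>
      let outs := iota nxt (nc g) in
      (g, take (nd g) (drop n w), outs)
        :: nodes (take n w ++ outs ++ drop (n + nd g) w) (nxt + nc g) d'
  end.
Definition nodes_of (k : nat) (d : seq lay) := nodes (iota 0 k) k d.

(** Extend a partial injection between wires of the pattern and wires of the
    diagram. *)
Definition bind1 (m : seq (nat * nat)) (x y : nat) : option (seq (nat * nat)) :=
  match filter (fun q => (q.1 == x) || (q.2 == y)) m with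
  | [::] => Some ((x, y) :: m)
  | [:: q] => if (q.1 == x) && (q.2 == y) then Some m else None
  | _ => None
  end.
Fixpoint bind (m : seq (nat * nat)) (xs ys : seq nat) : option (seq (nat * nat)) :=
  match xs, ys with
  | x :: xs', y :: ys' => obind (fun m' => bind m' xs' ys') (bind1 m x y)
  | [::], [::] => Some m
  | _, _ => None
  end.
Fixpoint assign (ns : seq (nat * node)) (pat : seq node) (m : seq (nat * nat))
    (used : seq nat) : seq (seq nat) :=
  match pat with
  | [::] => [:: rev used]
  | (g, i, o) :: pat' =>
      flatten [seq (let: (k, (g', i', o')) := kn in
                    if (g == g') && (k \notin used) then
                      if bind m (i ++ o) (i' ++ o') is Some m' then
                        assign ns pat' m' (k :: used) else [::]
                    else [::]) | kn <- ns]
  end.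

(* [below] expects the nodes in the order of composition, [above] reversed. *)
Fixpoint below (S ws : seq nat) (ns : seq (nat * node)) : seq nat :=
  match ns with
  | [::] => [::]
  | (k, (_, i, o)) :: ns' =>
      if (k \in S) || has (mem ws) i then k :: below S (o ++ ws) ns'
      else below S ws ns'
  end.
Fixpoint above (S ws : seq nat) (ns : seq (nat * node)) : seq nat :=
  match ns with
  | [::] => [::]
  | (k, (_, i, o)) :: ns' =>
      if (k \in S) || has (mem ws) o then k :: above S (i ++ ws) ns'
      else above S ws ns'
  end.

Record match_ := Match { at_ : nat; off : nat; lays : seq lay; how : seq move }.

Definition shift n (d : seq lay) : seq lay := [seq (n + x.1, x.2) | x <- d].

Definition try_order (d pat : seq lay) (up S down : seq nat) : option match_ :=
  if reorder (up ++ S ++ down) 0 (tag d) is Some (d', ms) then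
    let a := size up in
    let blk := take (size S) (drop a d') in
    let n := (head (0, Gcross L1 L1) blk).1 - (head (0, Gcross L1 L1) pat).1 in
    if blk == shift n pat then Some (Match a n d' ms) else None
  else None.

Fixpoint first T U (f : T -> option U) (s : seq T) : option U :=
  match s with
  | [::] => None
  | x :: s' => if f x is Some y then Some y else first f s'
  end.

(** Makes the layers in [S] consecutive.  A layer unrelated to them can go
    before or after; which choice leaves the strands of the match adjacent
    depends on the diagram, so that several are tried. *)
Definition match_at (d pat : seq lay) (ns : seq (nat * node)) (S : seq nat) :
    option match_ :=
  let B := below S [::] ns in let A := above S [::] (rev ns) in
  if has (fun k => (k \in A) && (k \notin S)) B then None else
  let ix := iota 0 (size d) in
  let U := [seq k <- ix | (k \notin A) && (k \notin B)] in
  let go t :=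
    let V := take t U in
    try_order d pat [seq k <- ix | ((k \in A) && (k \notin S)) || (k \in V)] S
      [seq k <- ix | (k \notin S) && (k \notin A) && (k \notin V)] in
  first go (size U :: iota 0 (size U)).

Definition gens (d : seq lay) : seq gen := [seq x.2 | x <- d].

(** An equation for the search: its reference, the number of strands of its
    source, its sides. *)
Definition srule := (reference * (nat * seq lay * seq lay))%type.
Definition state := (seq lay * seq move)%type.

Definition contract (r : srule) (m : match_) : state :=
  let: (i, (k, a, b)) := r in
  (take (at_ m) (lays m) ++ shift (off m) b ++ drop (at_ m + size a) (lays m),
   rcons (how m) (Rewrite (at_ m) (off m) i)).

Section Matching.
Variables (k : nat) (d : seq lay) (r : srule).
Let pat := r.2.1.2.
Let ns := nodes_of k d.
Let tagged := zip (iota 0 (size ns)) ns.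
Definition embeddings : seq (seq nat) :=
  if all (fun x => x \in gens d) (gens pat) then
    assign tagged (nodes_of r.2.1.1 pat) [::] [::]
  else [::].
Definition apply_all : seq state :=
  map (contract r) (pmap (match_at d pat tagged) embeddings).
Definition apply_first : option state :=
  omap (contract r) (first (match_at d pat tagged) embeddings).
End Matching.

Definition boxes : seq box :=
  [:: bm1; bη1; bΔ1; bε1; bm2; bη2; bΔ2; bε2; bμl; bμr; bνl; bνr; bρ; bσ;
      bα; bβ; bλ; bζ; bφ12; bφ21; bσhat; bρhat; bκ; bω;
      bT1; bT2; bT; bV1; bV2; bV; bm; bΔ].
Definition gen_code (g : gen) : nat :=
  match g with
  | Gbox b => index b boxes
  | Gcross L1 L1 => 100 | Gcross L1 L2 => 101
  | Gcross L2 L1 => 102 | Gcross L2 L2 => 103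
  end.
Definition better (x y : lay) : bool :=
  (x.1 < y.1) || (x.1 == y.1) &&
  ((nd y.2 < nd x.2) || (nd y.2 == nd x.2) && (gen_code x.2 < gen_code y.2)).

(** Sorts the layers by always pulling the best available one to the front, so
    that diagrams equal up to interchange mostly become syntactically equal. *)
Fixpoint canon (fuel pos : nat) (d : seq (nat * lay)) : state :=
  if fuel is fuel'.+1 then
    let cand := pmap (fun x => pull x.1 d) d in
    match cand with
    | [::] => ([::], [::])
    | c :: cs =>
        let: (x, d', n) :=
          foldl (fun b y => if better y.1.1.2 b.1.1.2 then y else b) c cs in
        let: (l, ms) := canon fuel' pos.+1 d' in
        (x.2 :: l, swaps pos n ++ ms)
    end
  else ([::], [::]).
Definition canonical (s : state) : state :=
  let: (d, ms) := s in
  let: (d', ms') := canon (size d) 0 (tag d) in (d', ms ++ ms').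

Definition relevant (d : seq lay) (tb : seq (gen * seq srule)) : seq srule :=
  flatten [seq (if x.1 \in gens d then x.2 else [::]) | x <- tb].

Fixpoint simplify (fuel k : nat) (tb : seq (gen * seq srule)) (us : seq srule)
    (s : state) : state :=
  if fuel is fuel'.+1 then
    if first (apply_first k s.1) (us ++ relevant s.1 tb) is Some (d, ms) then
      simplify fuel' k tb us (d, s.2 ++ ms)
    else s
  else s.

Fixpoint bfs (R : Type) (fuel k : nat) tb us (test : seq lay -> option R)
    (queue : seq state) (seen : seq (seq lay)) : option (R * seq move) :=
  if fuel is fuel'.+1 then
    match queue with
    | [::] => None
    | (d, ms) :: q =>
        if test d is Some r then Some (r, ms) else
        let new := flatten [seq map canonical (apply_all k d r)
                           | r <- us ++ relevant d tb] in
        let: (fresh, seen') :=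
          foldl (fun acc s => if s.1 \in acc.2 then acc
                              else (rcons acc.1 (s.1, ms ++ s.2), s.1 :: acc.2))
                ([::], seen) new in
        bfs fuel' k tb us test (q ++ fresh) seen'
    end
  else None.

(** Simplification applies the equations [units] and the slides of
    [stb] as long as possible.  A step applies a prescribed equation; if it has
    no match, the slides of [mtb] and the equations [assocs] are tried until it
    has one. *)
Section Steps.
Variables (stb mtb : seq (gen * seq srule)) (units assocs : seq srule) (k : nat).
Definition normal (s : state) : state := canonical (simplify 500 k stb units s).
Definition step (s : state) (r : nat * srule) : option state :=
  let occurrence d := ohead (drop r.1 (apply_all k d r.2)) in
  if bfs 400 k mtb assocs occurrence [:: (s.1, [::])] [:: s.1]
    is Some ((d, ms'), ms) then Some (normal (d, s.2 ++ ms ++ ms'))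
  else None.
Definition steps (d : seq lay) (rs : seq (nat * srule)) : option state :=
  foldl (fun s r => obind (step^~ r) s) (Some (normal (d, [::]))) rs.
Definition meet (s t : state) : option (seq move * seq move) :=
  let reached d := if d == t.1 then Some tt else None in
  if bfs 200 k mtb assocs reached [:: (s.1, [::])] [:: s.1] is Some (_, ms) then
    Some (s.2 ++ ms, t.2)
  else None.
End Steps.

Definition to_srule (i : reference) (r : rule) : srule :=
  let: (w, a, b) := r in (i, (size w, flat a, flat b)).
Definition index_rules (n : nat) (rs : seq rule) : seq srule :=
  [seq to_srule (Known x.1) x.2 | x <- zip (iota n (size rs)) rs].
Definition all_gens : seq gen :=
  map Gbox boxes ++ [:: Gcross L1 L1; Gcross L1 L2; Gcross L2 L1; Gcross L2 L2].
Definition slides_of (flip : bool) (g : gen) : seq srule :=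
  [seq to_srule (Slide g cl.1 cl.2 flip) (slide g cl.1 cl.2 flip)
  | cl <- [:: (L1, false); (L1, true); (L2, false); (L2, true)]].
Definition moving_table : seq (gen * seq srule) :=
  [seq (g, [seq r <- slides_of false g ++ slides_of true g | 1 < size r.2.1.2])
  | g <- all_gens].
(* Boxes move past crossings towards the end of the composition, counits towards
   its start; crossings with a unit or a counit thereby disappear. *)
Definition simplifying_table : seq (gen * seq srule) :=
  [seq (g, if g is Gcross _ _ then [::] else slides_of (nilp (cod g)) g)
  | g <- all_gens].
End Find.

Definition rule_of (e : expr * expr) : rule := (src e.1, layers e.1, layers e.2).

(** Proposes moves from [l] and from [r] to a common diagram.  [hl] and [hr]
    prescribe the equations to apply on either side, each with the index of the
    occurrence to rewrite. *)
Definition find (units assocs : seq (expr * expr))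
    (hl hr : seq (nat * (expr * expr))) (l r : expr) :
    option (seq move * seq move) :=
  let rules n es := Find.index_rules n (map rule_of es) in
  let hints n hs := zip (map fst hs) (rules n (map snd hs)) in
  let n := size hl + size hr in
  let as_ := rules n assocs in
  let us := rules (n + size assocs) units in
  let st := Find.simplifying_table in let mt := Find.moving_table in
  let k := size (src l) in
  let run e hs := Find.steps st mt us as_ k (Find.flat (layers e)) hs in
  if run l (hints 0 hl) is Some s then
    if run r (hints (size hl) hr) is Some t then Find.meet mt as_ k s t else None
  else None.

(** * Morphisms as elements of a single type *)

(** Packing a morphism with its source and target makes strict associativity of
    the tensor product an equation without casts.  Composition becomes partial:
    [None] stands for a composite of morphisms that do not match. *)
Record arrow (C : category) :=
  Arrow { arrow_src : C; arrow_tgt : C; arrow_mor : Hom arrow_src arrow_tgt }.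
Definition arr (C : category) (A B : C) (f : Hom A B) : option (arrow C) :=
  Some (Arrow f).
Definition acomp (C : category) (f g : option (arrow C)) : option (arrow C) :=
  match f, g with
  | Some (Arrow B' D f), Some (Arrow A B g) =>
      match excluded_middle_informative (B = B') with
      | left e => arr (compm f (castm erefl e g))
      | right _ => None
      end
  | _, _ => None
  end.
Definition atens (C : strict_monoidal_category) (f g : option (arrow C)) : option (arrow C) :=
  match f, g with
  | Some (Arrow A B f), Some (Arrow A' B' g) => arr (tensm f g)
  | _, _ => None
  end.
Arguments acomp {C} f g : simpl never.
Arguments atens {C} f g : simpl never.

Section Arrows.
Variable C : strict_monoidal_category.
Implicit Types (A B D : C) (x y z : option (arrow C)).

(** Uniqueness of identity proofs between objects makes packing injective, so that
    equations of packed morphisms can be brought back to equations of morphisms. *)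
Lemma arr_inj A B (f g : Hom A B) : arr f = arr g -> f = g.
Proof.
move=> /(congr1 (odflt (Arrow f))) /= H.
pose P (u : arrow C) := forall (eA : arrow_src u = A) (eB : arrow_tgt u = B),
  castm eA eB (arrow_mor u) = g.
have : P (Arrow f).
  rewrite H /P /= => eA eB.
  by rewrite (UIP_refl _ _ eA) (UIP_refl _ _ eB).
by move=> /(_ erefl erefl).
Qed.

Lemma arr_cast A A' B B' (eA : A = A') (eB : B = B') (f : Hom A B) :
  arr (castm eA eB f) = arr f.
Proof. by case: _ / eA; case: _ / eB. Qed.

Lemma acompE A B D (f : Hom B D) (g : Hom A B) :
  acomp (arr f) (arr g) = arr (compm f g).
Proof.
rewrite /acomp /=; case: excluded_middle_informative => // e.
by rewrite (UIP_refl _ _ e).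
Qed.

Lemma atensE A B A' B' (f : Hom A B) (g : Hom A' B') :
  atens (arr f) (arr g) = arr (tensm f g).
Proof. by []. Qed.

Lemma acomp0x x : acomp None x = None.
Proof. by []. Qed.

Lemma acompx0 x : acomp x None = None.
Proof. by case: x => [[A B f]|]. Qed.

Lemma acomp_neq A B A' B' (f : Hom A B) (g : Hom A' B') : A <> B' ->
  acomp (arr f) (arr g) = None.
Proof.
by move=> ne; rewrite /acomp /=; case: (excluded_middle_informative (B' = A)) => // e; case: ne.
Qed.

Lemma acompA x y z : acomp x (acomp y z) = acomp (acomp x y) z.
Proof.
case: x => [[A B f]|]; last by rewrite !acomp0x.
case: y => [[A' B' g]|]; last by rewrite /= !acompx0.
case: z => [[A'' B'' k]|]; last by rewrite !acompx0.
rewrite -!/(arr _).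
have [e|ne] := classic (A = B'); have [e'|ne'] := classic (A' = B''); subst.
- by rewrite !acompE compmA.
- by rewrite acompE !acomp_neq // acompx0.
- by rewrite acompE !acomp_neq.
- by rewrite !acomp_neq // acompx0.
Qed.

Lemma atensA x y z : atens (atens x y) z = atens x (atens y z).
Proof.
case: x y z => [[A B f]|] [[A' B' g]|] [[A'' B'' k]|] //=.
rewrite /atens /= -(arr_cast (tensA _ _ _) (tensA _ _ _)); congr arr.
exact: tensmA.
Qed.

Lemma atens1x x : atens (arr (idm unitO)) x = x.
Proof.
case: x => [[A B f]|] //.
by rewrite /atens /= -(arr_cast (tens1O _) (tens1O _)) tens1m.
Qed.

Lemma atensx1 x : atens x (arr (idm unitO)) = x.
Proof.
case: x => [[A B f]|] //.
by rewrite /atens /= -(arr_cast (tensO1 _) (tensO1 _)) tensm1.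
Qed.

Definition hom A B x := exists f : Hom A B, x = arr f.

Lemma homE A B (f : Hom A B) : hom A B (arr f).
Proof. by exists f. Qed.

Lemma hom_comp A B D x y : hom B D x -> hom A B y -> hom A D (acomp x y).
Proof. by move=> [f ->] [g ->]; rewrite acompE; exists (compm f g). Qed.

Lemma hom_tens A B A' B' x y : hom A B x -> hom A' B' y ->
  hom (tens A A') (tens B B') (atens x y).
Proof. by move=> [f ->] [g ->]; rewrite atensE; exists (tensm f g). Qed.

Lemma acomp1x A B x : hom A B x -> acomp (arr (idm B)) x = x.
Proof. by move=> [f ->]; rewrite acompE comp1m. Qed.

Lemma acompx1 A B x : hom A B x -> acomp x (arr (idm A)) = x.
Proof. by move=> [f ->]; rewrite acompE compm1. Qed.

Lemma atens_comp A B D A' B' D' x y x' y' :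
  hom B D x -> hom A B y -> hom B' D' x' -> hom A' B' y' ->
  atens (acomp x y) (acomp x' y') = acomp (atens x x') (atens y y').
Proof.
move=> [f ->] [g ->] [f' ->] [g' ->].
by rewrite !acompE !atensE tensm_comp.
Qed.

End Arrows.

(** * Values of diagrams *)

Section Interpretation.
Variables (C : strict_braided_category) (ob : letter -> C).
Implicit Types (u v w : word).

Fixpoint V w : C := if w is a :: w' then tens (ob a) (V w') else unitO.
Definition ida w : option (arrow C) := arr (idm (V w)).
Definition brw u v : option (arrow C) := arr (braid (V u) (V v)).

Lemma V_cat u v : V (u ++ v) = tens (V u) (V v).
Proof.
elim: u => [|a u IHu] /=; first by rewrite tens1O.
by rewrite IHu tensA.
Qed.

Lemma ida_cat u v : ida (u ++ v) = atens (ida u) (ida v).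
Proof. by rewrite /ida atensE tensm_id V_cat. Qed.

Lemma hom_ida w : hom (V w) (V w) (ida w).
Proof. exact: homE. Qed.

Lemma hom_tensw u v u' v' x y : hom (V u) (V v) x -> hom (V u') (V v') y ->
  hom (V (u ++ u')) (V (v ++ v')) (atens x y).
Proof. by rewrite !V_cat; exact: hom_tens. Qed.

Lemma hom_brw u v : hom (V (u ++ v)) (V (v ++ u)) (brw u v).
Proof. by rewrite !V_cat; exact: homE. Qed.

Lemma braid_eq (A A' B B' : C) : A = A' -> B = B' -> arr (braid A B) = arr (braid A' B').
Proof. by move=> -> ->. Qed.

Lemma arr_braid_tensr (A B D : C) :
  arr (braid A (tens B D)) =
  acomp (atens (arr (idm B)) (arr (braid A D))) (atens (arr (braid A B)) (arr (idm D))).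
Proof.
rewrite braid_tensr -acompE !arr_cast !atensE //.
Qed.

Lemma arr_braid_tensl (A B D : C) :
  arr (braid (tens A B) D) =
  acomp (atens (arr (braid A D)) (arr (idm B))) (atens (arr (idm A)) (arr (braid B D))).
Proof.
rewrite braid_tensl -acompE !arr_cast !atensE //.
Qed.

Lemma hom_brw' u v : exists2 y, hom (V (v ++ u)) (V (u ++ v)) y &
  acomp y (brw u v) = ida (u ++ v) /\ acomp (brw u v) y = ida (v ++ u).
Proof.
have [g [gb bg]] := braid_iso (V u) (V v).
exists (arr g); first by rewrite !V_cat; exact: homE.
by rewrite /brw !acompE gb bg !ida_cat /ida !atensE !tensm_id.
Qed.

(** The braiding with the unit object is not assumed to be trivial.  By the hexagon
    laws it is idempotent, and it is invertible, hence it is an identity. *)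
Lemma idem_iso_id (A : C) x y : hom A A x ->
  acomp y x = arr (idm A) -> acomp x x = x -> x = arr (idm A).
Proof. by move=> hx yx xx; rewrite -yx -[in RHS]xx acompA yx (acomp1x hx). Qed.

Lemma brw0 u : brw u [::] = ida u.
Proof.
have [y _ [yb _]] := hom_brw' u [::]; rewrite cats0 in yb.
apply: (idem_iso_id _ yb); first by have := hom_brw u [::]; rewrite cats0.
have := arr_braid_tensr (V u) unitO unitO.
rewrite atens1x atensx1 => <-.
by apply: braid_eq => //; rewrite tens1O.
Qed.

Lemma br0w v : brw [::] v = ida v.
Proof.
have [y _ [yb _]] := hom_brw' [::] v; rewrite /= in yb.
apply: (idem_iso_id _ yb); first by have := hom_brw [::] v; rewrite cats0.
have := arr_braid_tensl unitO unitO (V v).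
rewrite atens1x atensx1 => <-.
by apply: braid_eq => //; rewrite tens1O.
Qed.

Lemma brw_catr u v1 v2 : brw u (v1 ++ v2) =
  acomp (atens (ida v1) (brw u v2)) (atens (brw u v1) (ida v2)).
Proof. by rewrite -arr_braid_tensr /brw V_cat. Qed.

Lemma brw_catl u1 u2 v : brw (u1 ++ u2) v =
  acomp (atens (brw u1 v) (ida u2)) (atens (ida u1) (brw u2 v)).
Proof. by rewrite -arr_braid_tensl /brw V_cat. Qed.

Lemma brw_nat u u' v v' x y : hom (V u) (V u') x -> hom (V v) (V v') y ->
  acomp (brw u' v') (atens x y) = acomp (atens y x) (brw u v).
Proof. by move=> [f ->] [g ->]; rewrite !atensE /brw !acompE braid_nat. Qed.

Variable itp : box -> option (arrow C).
Hypothesis itpP : forall b, hom (V (arity b).1) (V (arity b).2) (itp b).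

Definition igen (g : gen) : option (arrow C) :=
  match g with Gbox b => itp b | Gcross a b => brw [:: a] [:: b] end.

Lemma hom_igen g : hom (V (dom g)) (V (cod g)) (igen g).
Proof. by case: g => [b|a b] /=; [exact: itpP|exact: (hom_brw [:: a] [:: b])]. Qed.

Definition ilayer (l : layer) : option (arrow C) :=
  atens (ida l.1.1) (atens (igen l.1.2) (ida l.2)).
Definition sem w (d : seq layer) : option (arrow C) :=
  foldl (fun x l => acomp (ilayer l) x) (ida w) d.

Definition lsrc (l : layer) := l.1.1 ++ dom l.1.2 ++ l.2.
Definition ltgt (l : layer) := l.1.1 ++ cod l.1.2 ++ l.2.
Fixpoint path u (d : seq layer) v : bool :=
  if d is l :: d' then (u == lsrc l) && path (ltgt l) d' v else u == v.

Lemma hom_ilayer l : hom (V (lsrc l)) (V (ltgt l)) (ilayer l).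
Proof.
by apply: hom_tensw; [exact: hom_ida|apply: hom_tensw; [exact: hom_igen|exact: hom_ida]].
Qed.

Lemma path_cat u d1 d2 v w : path u d1 v -> path v d2 w -> path u (d1 ++ d2) w.
Proof.
elim: d1 u => [|l d1 IHd] u /=; first by move=> /eqP->.
by case/andP=> -> /IHd h /h.
Qed.

Lemma path_inj u d v v' : path u d v -> path u d v' -> v = v'.
Proof.
elim: d u => [|l d IHd] u /=; first by move=> /eqP<- /eqP.
by case/andP=> _ h /andP[_] /(IHd _ h).
Qed.

Lemma foldl_sem (A : C) w d v x : hom A (V w) x -> path w d v ->
  foldl (fun y l => acomp (ilayer l) y) x d = acomp (sem w d) x.
Proof.
elim: d A w x => [|k d IHd] A w x hx /=; first by move=> _; rewrite (acomp1x hx).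
case/andP=> /eqP ew h; subst w; have hk := hom_ilayer k.
rewrite (IHd _ _ _ (hom_comp hk hx) h) /sem /=.
by rewrite (acompx1 hk) (IHd _ _ _ hk h) acompA.
Qed.

Lemma sem_cons u l d v : u = lsrc l -> path (ltgt l) d v ->
  sem u (l :: d) = acomp (sem (ltgt l) d) (ilayer l).
Proof.
move=> -> h; have hl := hom_ilayer l.
by rewrite /sem /= (acompx1 hl) (foldl_sem hl h).
Qed.

Lemma sem_hom u d v : path u d v -> hom (V u) (V v) (sem u d).
Proof.
elim: d u => [|l d IHd] u /=; first by move=> /eqP->; exact: hom_ida.
case/andP=> /eqP e h; rewrite (sem_cons e h) e.
exact: hom_comp (IHd _ h) (hom_ilayer l).
Qed.

Lemma sem_cat u d1 v d2 w : path u d1 v -> path v d2 w ->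
  sem u (d1 ++ d2) = acomp (sem v d2) (sem u d1).
Proof.
elim: d1 u => [|l d1 IHd] u /=.
  by move=> /eqP-> h; rewrite {2}/sem /= (acompx1 (sem_hom h)).
case/andP=> /eqP e h1 h2.
rewrite (sem_cons e (path_cat h1 h2)) (sem_cons e h1) (IHd _ h1 h2).
by rewrite acompA.
Qed.

Lemma whisk_cat p s d1 d2 : whisk p s (d1 ++ d2) = whisk p s d1 ++ whisk p s d2.
Proof. exact: map_cat. Qed.

Lemma path_whisk p s u d v : path u d v -> path (p ++ u ++ s) (whisk p s d) (p ++ v ++ s).
Proof.
elim: d u => [|l d IHd] u /=; first by move=> /eqP->.
case/andP=> /eqP-> /IHd; rewrite /lsrc /ltgt /= -!catA => ->.
by rewrite eqxx.
Qed.

Lemma ilayer_whisk p s l :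
  ilayer (p ++ l.1.1, l.1.2, l.2 ++ s) = atens (ida p) (atens (ilayer l) (ida s)).
Proof. by rewrite /ilayer /= !ida_cat !atensA. Qed.

Lemma atens_id_comp p s u v w x y : hom (V v) (V w) x -> hom (V u) (V v) y ->
  atens (ida p) (atens (acomp x y) (ida s)) =
  acomp (atens (ida p) (atens x (ida s))) (atens (ida p) (atens y (ida s))).
Proof.
move=> hx hy; have hp := hom_ida p; have hs := hom_ida s.
have e2 : atens (acomp x y) (ida s) = acomp (atens x (ida s)) (atens y (ida s)).
  by rewrite -[in LHS](acomp1x hs) (atens_comp hx hy hs hs).
rewrite e2 -[in LHS](acomp1x hp).
exact: (atens_comp hp hp (hom_tens hx hs) (hom_tens hy hs)).
Qed.

Lemma sem_whisk p s u d v : path u d v ->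
  sem (p ++ u ++ s) (whisk p s d) = atens (ida p) (atens (sem u d) (ida s)).
Proof.
elim: d u => [|l d IHd] u /=.
  by move=> _; rewrite /sem /= !ida_cat.
case/andP=> /eqP e h.
have e' : p ++ u ++ s = lsrc (p ++ l.1.1, l.1.2, l.2 ++ s).
  by rewrite e /lsrc /= -!catA.
have e2 : ltgt (p ++ l.1.1, l.1.2, l.2 ++ s) = p ++ ltgt l ++ s.
  by rewrite /ltgt /= -!catA.
rewrite (sem_cons e' (v := p ++ v ++ s)); last by rewrite e2; exact: path_whisk.
rewrite e2 IHd // ilayer_whisk (sem_cons e h) (atens_id_comp _ _ (sem_hom h) (hom_ilayer l)) //.
Qed.

Lemma sem_nil u : sem u [::] = ida u.
Proof. by []. Qed.

Lemma sem1 l : sem (lsrc l) [:: l] = ilayer l.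
Proof. by rewrite /sem /= (acompx1 (hom_ilayer l)). Qed.

Lemma sem_glayer g : sem (dom g) [:: glayer g] = igen g.
Proof.
have := sem1 (glayer g); rewrite /lsrc /= cats0 => ->.
by rewrite /ilayer /= /ida /= atens1x atensx1.
Qed.

Lemma path_glayer g : path (dom g) [:: glayer g] (cod g).
Proof. by rewrite /= /lsrc /ltgt /= !cats0 !eqxx. Qed.

Lemma whisk0 d : whisk [::] [::] d = d.
Proof.
by elim: d => //= -[[p g] s] d ->; rewrite /= cats0.
Qed.

Lemma path_whiskl p u d v : path u d v -> path (p ++ u) (whisk p [::] d) (p ++ v).
Proof. by move=> /(path_whisk p [::]); rewrite !cats0. Qed.
Lemma path_whiskr s u d v : path u d v -> path (u ++ s) (whisk [::] s d) (v ++ s).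
Proof. exact: (@path_whisk [::] s). Qed.
Lemma sem_whiskl p u d v : path u d v ->
  sem (p ++ u) (whisk p [::] d) = atens (ida p) (sem u d).
Proof.
by move=> h; have := sem_whisk p [::] h; rewrite cats0 => ->; rewrite atensx1.
Qed.
Lemma sem_whiskr s u d v : path u d v ->
  sem (u ++ s) (whisk [::] s d) = atens (sem u d) (ida s).
Proof.
by move=> h; have := sem_whisk [::] s h => /= ->; rewrite atens1x.
Qed.

Lemma cross1_ok a v :
  path (a :: v) (cross1 a v) (v ++ [:: a]) /\ sem (a :: v) (cross1 a v) = brw [:: a] v.
Proof.
elim: v => [|b v [IHp IHs]] /=; first by rewrite eqxx sem_nil brw0.
have hp : path (a :: b :: v) [:: ([::], Gcross a b, v)] (b :: a :: v).
  by rewrite /= /lsrc /ltgt /= !eqxx.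
have hw := path_whiskl [:: b] IHp.
split; first by have := path_cat hp hw.
rewrite -[_ :: whisk _ _ _]cat1s (sem_cat hp hw) (sem_whiskl [:: b] IHp) IHs.
rewrite (brw_catr [:: a] [:: b] v); congr acomp.
rewrite -[a :: b :: v]/(lsrc ([::], Gcross a b, v)) sem1 /ilayer /=.
by rewrite atens1x.
Qed.

Lemma cross_ok u v : path (u ++ v) (cross u v) (v ++ u) /\ sem (u ++ v) (cross u v) = brw u v.
Proof.
elim: u => [|a u [IHp IHs]] /=; first by rewrite cats0 eqxx sem_nil br0w.
have [hp hs] := cross1_ok a v.
have h1 := path_whiskl [:: a] IHp; have h2 := path_whiskr u hp.
rewrite -catA /= in h2.
split; first exact: path_cat h1 h2.
rewrite (sem_cat h1 h2) (sem_whiskl [:: a] IHp) (sem_whiskr u hp) IHs hs.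
by rewrite -(brw_catl [:: a] u v).
Qed.

Lemma rot_word_cat u v : rot_word (u ++ v) = rot_word v ++ rot_word u.
Proof. by rewrite /rot_word map_cat rev_cat. Qed.

Lemma rot_dom g : rot_word (dom g) = cod (rot_gen g).
Proof. by case: g => [[]|[] []]. Qed.
Lemma rot_cod g : rot_word (cod g) = dom (rot_gen g).
Proof. by case: g => [[]|[] []]. Qed.

Lemma rot_lsrc l : ltgt (rot_layer l) = rot_word (lsrc l).
Proof. by rewrite /lsrc /ltgt /= !rot_word_cat rot_dom !catA. Qed.
Lemma rot_ltgt l : lsrc (rot_layer l) = rot_word (ltgt l).
Proof. by rewrite /lsrc /ltgt /= !rot_word_cat rot_cod !catA. Qed.

Lemma rot_layers_cat d1 d2 : rot_layers (d1 ++ d2) = rot_layers d2 ++ rot_layers d1.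
Proof. by rewrite /rot_layers map_cat rev_cat. Qed.

Lemma rot_layers_cons l d : rot_layers (l :: d) = rot_layers d ++ [:: rot_layer l].
Proof. by rewrite /rot_layers /= rev_cons cats1. Qed.

Lemma path_rot u d v : path u d v -> path (rot_word v) (rot_layers d) (rot_word u).
Proof.
elim: d u => [|l d IHd] u /=; first by move=> /eqP->; exact: eqxx.
case/andP=> /eqP-> /IHd h; rewrite rot_layers_cons; apply: (path_cat h).
by rewrite /= rot_ltgt rot_lsrc !eqxx.
Qed.

Lemma rot_whisk p s d :
  rot_layers (whisk p s d) = whisk (rot_word s) (rot_word p) (rot_layers d).
Proof.
elim: d => //= l d IHd; rewrite !rot_layers_cons IHd whisk_cat; congr cat.
by rewrite /whisk /= /rot_layer /= !rot_word_cat.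
Qed.

Lemma rot_cross1_ok a v :
  sem (rot_letter a :: rot_word v) (rot_layers (cross1 a v)) =
  brw [:: rot_letter a] (rot_word v).
Proof.
elim: v => [|b v IHs]; first by rewrite sem_nil brw0.
have hr : rot_word (b :: v) = rot_word v ++ [:: rot_letter b] by exact: (rot_word_cat [:: b]).
have hr' := rot_word_cat v [:: a].
have := path_rot (proj1 (cross1_ok a v)); rewrite hr' => hp.
have hr2 : rot_word (a :: v) = rot_word v ++ [:: rot_letter a] by exact: (rot_word_cat [:: a]).
rewrite hr2 in hp.
rewrite hr /= rot_layers_cons rot_whisk.
have h1 := path_whiskr [:: rot_letter b] hp; rewrite /= -catA in h1.
pose l : layer := (rot_word v, Gcross (rot_letter a) (rot_letter b), [::]).
have h2 : path (rot_word v ++ [:: rot_letter a; rot_letter b]) [:: l]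
            (rot_word v ++ [:: rot_letter b; rot_letter a]).
  by rewrite /= /lsrc /ltgt /= !eqxx.
have -> : rot_layer ([::], Gcross a b, v) = l by [].
rewrite (sem_cat h1 h2) -[_ :: _ ++ [:: rot_letter b]]/((_ :: _) ++ _).
rewrite (sem_whiskr _ hp) IHs (brw_catr _ (rot_word v) [:: _]); congr acomp.
have -> : rot_word v ++ [:: rot_letter a; rot_letter b] = lsrc l by [].
by rewrite sem1 /ilayer /= /ida /= atensx1.
Qed.

Lemma rot_cross_ok u v :
  sem (rot_word u ++ rot_word v) (rot_layers (cross u v)) = brw (rot_word u) (rot_word v).
Proof.
elim: u => [|a u IHs]; first by rewrite sem_nil br0w.
have hr : rot_word (a :: u) = rot_word u ++ [:: rot_letter a] by exact: (rot_word_cat [:: a]).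
rewrite hr /= rot_layers_cat !rot_whisk.
have := path_rot (proj1 (cross1_ok a v)); rewrite rot_word_cat (rot_word_cat [:: a] v) /= => hp.
have := path_rot (proj1 (cross_ok u v)); rewrite !rot_word_cat => hq.
have h1 := path_whiskl (rot_word u) hp; have h2 := path_whiskr [:: rot_letter a] hq.
rewrite -!catA in h1 h2.
rewrite -catA (sem_cat h1 h2) (sem_whiskl _ hp) catA (sem_whiskr _ hq) IHs rot_cross1_ok.
by rewrite -brw_catl.
Qed.

(** * Soundness of the moves *)

(** All moves are checked for a diagram and for its dual at once.  Keeping both
    equations together makes every derived law come with its dual. *)
Definition same w z d d' : Prop :=
  [/\ path w d z, path w d' z, sem w d = sem w d' &
      sem (rot_word z) (rot_layers d) = sem (rot_word z) (rot_layers d')].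

Lemma same_refl w z d : path w d z -> same w z d d.
Proof. by split. Qed.
Lemma same_sym w z d d' : same w z d d' -> same w z d' d.
Proof. by case. Qed.
Lemma same_trans w z d d' d'' : same w z d d' -> same w z d' d'' -> same w z d d''.
Proof. by move=> [h _ e1 e2] [_ h' e1' e2']; split=> //; [rewrite e1|rewrite e2]. Qed.

Lemma same_cons w z l d d' : w = lsrc l -> same (ltgt l) z d d' -> same w z (l :: d) (l :: d').
Proof.
move=> -> [h h' e1 e2]; split; rewrite /= ?eqxx //.
  by rewrite (sem_cons erefl h) (sem_cons erefl h') e1.
rewrite !rot_layers_cons.
have hl : path (rot_word (ltgt l)) [:: rot_layer l] (rot_word (lsrc l)).
  by rewrite /= rot_ltgt rot_lsrc !eqxx.
by rewrite (sem_cat (path_rot h) hl) (sem_cat (path_rot h') hl) e2.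
Qed.

Lemma same_ctx w z u v p s a b d : same u v a b -> w = p ++ u ++ s ->
  path (p ++ v ++ s) d z -> same w z (whisk p s a ++ d) (whisk p s b ++ d).
Proof.
move=> [ha hb e1 e2] -> hd.
have wa := path_whisk p s ha; have wb := path_whisk p s hb.
have ra := path_rot ha; have rb := path_rot hb; have rd := path_rot hd.
split; try exact: path_cat hd.
  by rewrite (sem_cat wa hd) (sem_cat wb hd) (sem_whisk p s ha) (sem_whisk p s hb) e1.
rewrite !rot_layers_cat !rot_whisk; rewrite !rot_word_cat -catA in rd.
have xa := path_whisk (rot_word s) (rot_word p) ra.
have xb := path_whisk (rot_word s) (rot_word p) rb.
rewrite (sem_cat rd xa) (sem_cat rd xb).
by rewrite (sem_whisk _ _ ra) (sem_whisk _ _ rb) e2.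
Qed.

Lemma path_catP u d1 d2 w : path u (d1 ++ d2) w -> exists2 v, path u d1 v & path v d2 w.
Proof.
elim: d1 u => [|l d1 IHd] u /=; first by move=> h; exists u.
by case/andP=> -> /IHd [v h1 h2]; exists v.
Qed.

Lemma sem2 l k : ltgt l = lsrc k -> sem (lsrc l) [:: l; k] = acomp (ilayer k) (ilayer l).
Proof.
move=> e; have hk : path (ltgt l) [:: k] (ltgt k) by rewrite /= e !eqxx.
by rewrite (sem_cons erefl hk) e sem1.
Qed.

Lemma exch_sem p g q k s :
  acomp (ilayer (p ++ cod g ++ q, k, s)) (ilayer (p, g, q ++ dom k ++ s)) =
  acomp (ilayer (p, g, q ++ cod k ++ s)) (ilayer (p ++ dom g ++ q, k, s)).
Proof.
rewrite /ilayer /= !ida_cat !atensA.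
have hp := hom_ida p; have hg := hom_igen g; have hk := hom_igen k; have hs := hom_ida s.
have hq := hom_ida q.
have hY : hom (V (q ++ dom k ++ s)) (V (q ++ cod k ++ s))
    (atens (ida q) (atens (igen k) (ida s))).
  exact: hom_tensw hq (hom_tensw hk hs).
rewrite -!ida_cat.
have h1 := hom_tens (hom_ida (cod g)) hY.
have h2 := hom_tens hg (hom_ida (q ++ dom k ++ s)).
have h3 := hom_tens hg (hom_ida (q ++ cod k ++ s)).
have h4 := hom_tens (hom_ida (dom g)) hY.
rewrite -(atens_comp hp hp h1 h2) -(atens_comp hp hp h3 h4).
rewrite -(atens_comp (hom_ida _) hg hY (hom_ida _)) -(atens_comp hg (hom_ida _) (hom_ida _) hY).
by rewrite (acomp1x hg) (acompx1 hg) (acomp1x hY) (acompx1 hY).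
Qed.

Lemma same_exch p g q k s :
  same (p ++ dom g ++ q ++ dom k ++ s) (p ++ cod g ++ q ++ cod k ++ s)
    [:: (p, g, q ++ dom k ++ s); (p ++ cod g ++ q, k, s)]
    [:: (p ++ dom g ++ q, k, s); (p, g, q ++ cod k ++ s)].
Proof.
split; try by rewrite /= /lsrc /ltgt /= -!catA !eqxx.
  rewrite -[p ++ _]/(lsrc (p, g, q ++ dom k ++ s)) sem2; last first.
    by rewrite /lsrc /ltgt /= -!catA.
  have -> : lsrc (p, g, q ++ dom k ++ s) = lsrc (p ++ dom g ++ q, k, s).
    by rewrite /lsrc /= -!catA.
  by rewrite sem2 ?exch_sem // /lsrc /ltgt /= -!catA.
rewrite /rot_layers /= /rev /= /rot_layer /= !rot_word_cat -!catA rot_dom rot_cod.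
set P := rot_word s; set Q := rot_word q; set S := rot_word p.
set G := rot_gen g; set K := rot_gen k; rewrite !rot_dom !rot_cod -/G -/K.
have -> : P ++ dom K ++ Q ++ dom G ++ S = lsrc (P, K, Q ++ dom G ++ S) by [].
rewrite [LHS]sem2; last by rewrite /lsrc /ltgt /= -!catA.
have -> : lsrc (P, K, Q ++ dom G ++ S) = lsrc (P ++ dom K ++ Q, G, S).
  by rewrite /lsrc /= -!catA.
by rewrite [RHS]sem2 ?exch_sem // /lsrc /ltgt /= -!catA.
Qed.

Lemma swap2_same l k x y : swap2 l k = Some (x, y) ->
  exists u, exists v, same u v [:: l; k] [:: x; y].
Proof.
case: l k => [[p g] s] [[p' g'] s'] /=; case: ifP => _; case: ifP => //;
  move: (drop _ _) => q /andP [/eqP -> /eqP ->] [<- <-].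
  by do 2!eexists; apply: same_sym; exact: same_exch.
by do 2!eexists; exact: same_exch.
Qed.

Lemma same_swap2 w z l k x y d : swap2 l k = Some (x, y) -> path w (l :: k :: d) z ->
  same w z (l :: k :: d) (x :: y :: d).
Proof.
move=> /swap2_same [u [v H]] P.
have [v' h1 h2] := @path_catP w [:: l; k] d z P.
have hu : path u [:: l; k] v by case: H.
have eu : w = u by case/andP: hu => /eqP-> _; case/andP: h1 => /eqP-> _.
subst u; rewrite (path_inj h1 hu) in h2.
have E := @same_ctx w z w v [::] [::] _ _ d H; rewrite !whisk0 in E.
by apply: E; rewrite /= cats0.
Qed.

Definition good (r : rule) : Prop := exists z, same r.1.1 z r.1.2 r.2.

Lemma goodI w z a b : same w z a b -> good (w, a, b).
Proof. by exists z. Qed.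

Lemma same_rewrite_front r n w z d d' : good r -> rewrite_front r n w d = Some d' ->
  path w d z -> same w z d d'.
Proof.
case: r => [[u a] b] [v /= H]; rewrite /rewrite_front.
case: ifP => // /andP [/eqP ew /eqP ed] [<-] P.
set p := take n w in ew ed *; set s := drop _ w in ew ed *.
rewrite -{1}(cat_take_drop (size a) d) ed.
rewrite -(cat_take_drop (size a) d) ed in P.
have [v' h1 h2] := path_catP P.
apply: (same_ctx H ew).
case: H => h _ _ _; have := path_whisk p s h; rewrite -ew => h'.
by rewrite -(path_inj h1 h').
Qed.

Lemma same_replay1 rs m k w z d d' : (forall i, good (lookup rs i)) ->
  replay1 rs m k w d = Some d' -> path w d z -> same w z d d'.
Proof.
move=> hrs; elim: k w d d' => [|k IHk] w [|l d] d' //=.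
- case: m => [//|k0 n i]; exact: same_rewrite_front.
- case: m => [k0|k0 n i]; last by move=> e P; apply: same_rewrite_front e P.
  case: d => // l2 d; case e: (swap2 l l2) => [[x y]|] // [<-]; exact: same_swap2.
case e: (replay1 _ _ _ _ _) => [d1|] //= [<-] /andP[/eqP ew P].
exact: same_cons (IHk _ _ _ e P).
Qed.

Lemma same_replay rs ms w z d d' : (forall i, good (lookup rs i)) ->
  replay rs ms w d = Some d' -> path w d z -> same w z d d'.
Proof.
move=> hrs; elim: ms d => [|m ms IHms] d /=; first by move=> [<-]; exact: same_refl.
case e: (replay1 _ _ _ _ _) => [d1|] //= e' P.
have H := same_replay1 hrs e P; apply: (same_trans H); apply: IHms e' _.
by case: H.
Qed.

(** Naturality of the braiding.  The dual of a slide is again naturality, but for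
    the dual generator, which is why the dual equation needs its own proof. *)
Lemma good_slide g c left flip : good (slide g c left flip).
Proof.
wlog -> : flip / flip = false.
  case: flip => [/(_ false erefl)|]; last exact.
  by rewrite /slide; case: left => -[z H]; exists z; exact: same_sym.
have hg := path_glayer g; have hc := hom_ida [:: c].
have rg := path_rot hg; rewrite rot_dom rot_cod in rg.
have rge : rot_layers [:: glayer g] = [:: glayer (rot_gen g)] by [].
rewrite rge in rg.
case: left; rewrite /slide.
  have [p1 s1] := cross_ok [:: c] (dom g); have [p2 s2] := cross_ok [:: c] (cod g).
  have r1 := rot_cross_ok [:: c] (dom g); have r2 := rot_cross_ok [:: c] (cod g).
  have q1 := path_rot p1; have q2 := path_rot p2.
  have w1 := path_whiskl [:: c] hg; have w2 := path_whiskr [:: c] hg.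
  apply: (@goodI _ (cod g ++ [:: c])); split.
  - exact: path_cat w1 p2.
  - exact: path_cat p1 w2.
  - rewrite (sem_cat w1 p2) (sem_cat p1 w2) (sem_whiskl _ hg) (sem_whiskr _ hg).
    by rewrite sem_glayer s1 s2 (brw_nat hc (hom_igen g)).
  rewrite [in LHS]rot_layers_cat [in RHS]rot_layers_cat
    (rot_whisk [:: c] [::] [:: glayer g]) (rot_whisk [::] [:: c] [:: glayer g]) rge.
  rewrite !rot_word_cat in q1 q2 *; rewrite rot_dom rot_cod in q1 q2 r1 r2 *.
  have v1 := path_whiskr (rot_word [:: c]) rg; have v2 := path_whiskl (rot_word [:: c]) rg.
  rewrite (sem_cat q2 v1) (sem_cat v2 q1) (sem_whiskl _ rg) (sem_whiskr _ rg).
  by rewrite sem_glayer r1 r2 (brw_nat (hom_ida _) (hom_igen (rot_gen g))).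
have [p1 s1] := cross_ok (dom g) [:: c]; have [p2 s2] := cross_ok (cod g) [:: c].
have r1 := rot_cross_ok (dom g) [:: c]; have r2 := rot_cross_ok (cod g) [:: c].
have q1 := path_rot p1; have q2 := path_rot p2.
have w1 := path_whiskl [:: c] hg; have w2 := path_whiskr [:: c] hg.
apply: (@goodI _ (c :: cod g)); split.
- exact: path_cat w2 p2.
- exact: path_cat p1 w1.
- rewrite (sem_cat w2 p2) (sem_cat p1 w1) (sem_whiskl _ hg) (sem_whiskr _ hg).
  by rewrite sem_glayer s1 s2 (brw_nat (hom_igen g) hc).
rewrite [in LHS]rot_layers_cat [in RHS]rot_layers_cat
    (rot_whisk [:: c] [::] [:: glayer g]) (rot_whisk [::] [:: c] [:: glayer g]) rge.
rewrite !rot_word_cat in q1 q2 *; rewrite rot_dom rot_cod in q1 q2 r1 r2 *.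
have v1 := path_whiskr (rot_word [:: c]) rg; have v2 := path_whiskl (rot_word [:: c]) rg.
rewrite (sem_cat q2 v2) (sem_cat v1 q1) (sem_whiskl _ rg) (sem_whiskr _ rg).
by rewrite sem_glayer r1 r2 (brw_nat (hom_igen (rot_gen g)) (hom_ida _)).
Qed.

(** * Values of expressions *)

(** Identities and crossings are interpreted through [wval], like in the data to
    be translated; [wvalE] relates this to [V], which is compositional. *)
Fixpoint value (e : expr) : option (arrow C) :=
  match e with
  | Box b => itp b
  | Id w => arr (idm (wval (map ob w)))
  | Cross u v => arr (braid (wval (map ob u)) (wval (map ob v)))
  | Comp f g => acomp (value f) (value g)
  | Tens f g => atens (value f) (value g)
  end.

Lemma wvalE w : wval (map ob w) = V w.
Proof.
by elim: w => // a w IHw; rewrite -[map ob _]/(ob a :: map ob w) -wval_cons IHw.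
Qed.

(** Layering an expression changes neither its value nor that of its dual. *)
Lemma value_ok e : typed e ->
  [/\ path (src e) (layers e) (tgt e), sem (src e) (layers e) = value e &
      sem (rot_word (tgt e)) (rot_layers (layers e)) = value (rot e)].
Proof.
elim: e => [b|w|u v|f IHf g IHg|f IHf g IHg] /=.
- move=> _; split; first exact: (path_glayer (Gbox b)).
    exact: (sem_glayer (Gbox b)).
  rewrite -[(arity b).2]/(cod (Gbox b)) rot_cod; exact: (sem_glayer (Gbox (rot_box b))).
- by move=> _; rewrite eqxx !sem_nil !wvalE.
- by move=> _; have [? ?] := cross_ok u v; rewrite rot_word_cat rot_cross_ok !wvalE.
- case/and3P=> /IHf [pf sf rf] /IHg [pg sg rg] /eqP e.
  rewrite e in pf sf.
  split; first exact: path_cat pg pf.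
    by rewrite (sem_cat pg pf) sf sg.
  rewrite rot_layers_cat (sem_cat (path_rot pf) (path_rot pg)) rf; congr acomp.
  exact: rg.
case/andP=> /IHf [pf sf rf] /IHg [pg sg rg].
have qf := path_rot pf; have qg := path_rot pg.
have h1 := path_whiskr (src g) pf; have h2 := path_whiskl (tgt f) pg.
split; first exact: path_cat h1 h2.
  rewrite (sem_cat h1 h2) (sem_whiskr _ pf) (sem_whiskl _ pg) sf sg.
  have hf := sem_hom pf; have hg := sem_hom pg; rewrite sf sg in hf hg.
  rewrite -(atens_comp (hom_ida _) hf hg (hom_ida _)) (acomp1x hf) (acompx1 hg) //.
rewrite rot_layers_cat !rot_whisk rot_word_cat.
have v1 := path_whiskr (rot_word (tgt f)) qg; have v2 := path_whiskl (rot_word (src g)) qf.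
rewrite (sem_cat v1 v2) (sem_whiskl _ qf) (sem_whiskr _ qg) rf rg.
have hf := sem_hom qf; have hg := sem_hom qg; rewrite rf rg in hf hg.
by rewrite -(atens_comp (hom_ida _) hg hf (hom_ida _)) (acomp1x hg) (acompx1 hf).
Qed.

End Interpretation.

(** * Equations in a structure, stated together with their duals *)

Declare Scope expr_scope.
Delimit Scope expr_scope with E.
Bind Scope expr_scope with expr.
Notation "f ∘ g" := (Comp f g) (at level 40, left associativity) : expr_scope.
Notation "f ⊗ g" := (Tens f g) (at level 45, right associativity) : expr_scope.
Notation "'Ψ' u v" := (Cross u v)
  (at level 10, u at level 9, v at level 9) : expr_scope.

Section Model.
Variables (C : strict_braided_category) (h : structure_data C).
Local Open Scope word_scope.
Local Notation id1 := (wid [:: B1 h]).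
Local Notation id2 := (wid [:: B2 h]).
Local Notation id12 := (wid [:: B1 h; B2 h]).
Local Notation Ψ11 := (Ψ [:: B1 h] [:: B1 h]).
Local Notation Ψ12 := (Ψ [:: B1 h] [:: B2 h]).
Local Notation Ψ21 := (Ψ [:: B2 h] [:: B1 h]).
Local Notation Ψ22 := (Ψ [:: B2 h] [:: B2 h]).

Definition warr (u v : seq C) (f : wHom u v) : option (arrow C) :=
  @arr C (wval u) (wval v) f.

Lemma warr_inj (u v : seq C) (f g : wHom u v) : warr f = warr g -> f = g.
Proof. exact: (@arr_inj C). Qed.
Lemma warr_comp (u v w : seq C) (f : wHom v w) (g : wHom u v) :
  warr (f ∘ g) = acomp (warr f) (warr g).
Proof. by rewrite /warr acompE. Qed.
Lemma warr_tens (u v u' v' : seq C) (f : wHom u v) (g : wHom u' v') :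
  warr (f ⊗ g) = atens (warr f) (warr g).
Proof. by rewrite /warr arr_cast. Qed.
Lemma warr_id (u : seq C) : warr (wid u) = arr (idm (wval u)).
Proof. by []. Qed.
Lemma warr_braid (u v : seq C) : warr (Ψ u v) = arr (braid (wval u) (wval v)).
Proof. by rewrite /warr arr_cast. Qed.
Lemma warr_group_dom (A B : C) (f : [:: A; B; A; B] ~> [:: A; B]) :
  warr (group_dom f) = warr f.
Proof. exact: arr_cast. Qed.
Lemma warr_group_cod (A B : C) (f : [:: A; B] ~> [:: A; B; A; B]) :
  warr (group_cod f) = warr f.
Proof. exact: arr_cast. Qed.

(** For a strong Hopf datum and in Sweedler notation, [T_of] sends x (x) h, with h
    in B1 (x) B2, to h1 (x) x.h2, where the dot is the action [α] of B1 (x) B2 on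
    B2; see [Δ_act].  [T1_of] is the case of h in B1, up to units.  [T2_of] is the
    case of h in B2, where the factor in B1 of h1 is the unit and is left out; see
    [ω_act]. *)
Definition T1_of : [:: B2 h; B1 h] ~> [:: B1 h; B2 h] :=
  (id1 ⊗ μr h) ∘ (Ψ21 ⊗ id1) ∘ (id2 ⊗ Δ1 h).
Definition T2_of : [:: B2 h; B2 h] ~> [:: B2 h; B2 h] :=
  (id2 ⊗ α h) ∘ (Ψ22 ⊗ id12) ∘ (id2 ⊗ β h).
Definition T_of : [:: B2 h; B1 h; B2 h] ~> [:: B1 h; B2 h; B2 h] :=
  (id1 ⊗ T2_of) ∘ (T1_of ⊗ id2).
Definition V1_of : [:: B1 h; B2 h] ~> [:: B2 h; B1 h] :=
  (m2 h ⊗ id1) ∘ (id2 ⊗ Ψ12) ∘ (νl h ⊗ id2).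
Definition V2_of : [:: B1 h; B1 h] ~> [:: B1 h; B1 h] :=
  (λ h ⊗ id1) ∘ (id12 ⊗ Ψ11) ∘ (ζ h ⊗ id1).
Definition V_of : [:: B1 h; B1 h; B2 h] ~> [:: B1 h; B2 h; B1 h] :=
  (id1 ⊗ V1_of) ∘ (V2_of ⊗ id2).

Definition ob (a : letter) : C := match a with L1 => B1 h | L2 => B2 h end.
Definition itp (b : box) : option (arrow C) :=
  match b with
  | bm1 => warr (m1 h) | bη1 => warr (η1 h) | bΔ1 => warr (Δ1 h) | bε1 => warr (ε1 h)
  | bm2 => warr (m2 h) | bη2 => warr (η2 h) | bΔ2 => warr (Δ2 h) | bε2 => warr (ε2 h)
  | bμl => warr (μl h) | bμr => warr (μr h) | bνl => warr (νl h) | bνr => warr (νr h)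
  | bρ => warr (ρ h) | bσ => warr (σ h)
  | bα => warr (α h) | bβ => warr (β h) | bλ => warr (λ h) | bζ => warr (ζ h)
  | bφ12 => warr (φ12 h) | bφ21 => warr (φ21 h)
  | bσhat => warr (σhat h) | bρhat => warr (ρhat h)
  | bκ => warr (κ h) | bω => warr (ω h)
  | bT1 => warr T1_of | bT2 => warr T2_of | bT => warr T_of
  | bV1 => warr V1_of | bV2 => warr V2_of | bV => warr V_of
  | bm => warr (cross_mul (φ21 h) (σhat h))
  | bΔ => warr (cross_comul (φ12 h) (ρhat h))
  end.

Lemma itpP b : hom (V ob (arity b).1) (V ob (arity b).2) (itp b).
Proof. by case: b; rewrite -!wvalE; exact: homE. Qed.

Definition value_of (e : expr) := value ob itp e.

(** An equation and its dual.  Since the axioms of a strong Hopf datum come in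
    dual pairs, every law derived below is of this form. *)
Definition holds (l r : expr) : Prop :=
  [/\ [&& typed l, typed r, src l == src r & tgt l == tgt r],
      value_of l = value_of r & value_of (rot l) = value_of (rot r)].

Lemma holds_sym l r : holds l r -> holds r l.
Proof.
by case=> /and4P[tl tr s t] e1 e2; split=> //; rewrite tl tr eq_sym s eq_sym t.
Qed.

Lemma holds_trans l k r : holds l k -> holds k r -> holds l r.
Proof.
case=> /and4P[tl tk /eqP s /eqP t] e1 e2 [/and4P[_ tr /eqP s' /eqP t'] e1' e2'].
by split; [rewrite tl tr s t s' t' !eqxx|rewrite e1|rewrite e2].
Qed.

Lemma rot_wordK : involutive rot_word.
Proof.
by move=> w; rewrite /rot_word map_rev revK -map_comp map_id_in // => -[].
Qed.

Lemma rotK : involutive rot.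
Proof.
by elim=> [[]|w|u v|f IHf g IHg|f IHf g IHg] //=; rewrite ?rot_wordK ?IHf ?IHg.
Qed.

Lemma rot_src e : src (rot e) = rot_word (tgt e).
Proof.
elim: e => [[]|w|u v|f IHf g IHg|f IHf g IHg] //=; first by rewrite rot_word_cat.
by rewrite IHf IHg rot_word_cat.
Qed.

Lemma rot_tgt e : tgt (rot e) = rot_word (src e).
Proof.
elim: e => [[]|w|u v|f IHf g IHg|f IHf g IHg] //=; first by rewrite rot_word_cat.
by rewrite IHf IHg rot_word_cat.
Qed.

Lemma rot_typed e : typed (rot e) = typed e.
Proof.
elim: e => [[]|w|u v|f IHf g IHg|f IHf g IHg] //=; last by rewrite IHf IHg andbC.
rewrite IHf IHg rot_src rot_tgt (inj_eq (can_inj rot_wordK)) andbCA.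
by rewrite [tgt g == _]eq_sym.
Qed.

Lemma dual l r : holds l r -> holds (rot l) (rot r).
Proof.
case=> /and4P[tl tr /eqP s /eqP t] e1 e2; split=> //; last by rewrite !rotK.
by rewrite !rot_typed !rot_src !rot_tgt tl tr s t !eqxx.
Qed.

(** A hint is an equation to be applied from left to right at its occurrence
    number [pick]. *)
Record hint := Hint { pick : nat; lhs : expr; rhs : expr; hintP : holds lhs rhs }.
Definition eqn (x : hint) := (lhs x, rhs x).
Definition use l r (p : holds l r) : hint := Hint 0 p.
Definition nth_hit n l r (p : holds l r) : hint := Hint n p.
Definition back l r (p : holds l r) : hint := Hint 0 (holds_sym p).
Definition back_dual l r (p : holds l r) : hint := Hint 0 (holds_sym (dual p)).

Lemma good_holds l r : holds l r -> good ob itp (rule_of (l, r)).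
Proof.
case=> /and4P[tl tr /eqP s /eqP t] e1 e2.
have [pl sl rl] := value_ok itpP tl; have [pr sr rr] := value_ok itpP tr.
exists (tgt l); rewrite /rule_of /=; split=> //; first by rewrite s t.
  by rewrite sl s sr.
by rewrite rl t rr.
Qed.

(** The decision to be computed: [ml] and [mr] lead from the two sides to the
    same diagram. *)
Definition agree (rs : seq rule) (ml mr : seq move) (l r : expr) : bool :=
  [&& typed l, typed r, src l == src r, tgt l == tgt r &
      if replay rs ml (src l) (layers l) is Some d then
        replay rs mr (src r) (layers r) == Some d else false].

Lemma nth_hints (s : seq hint) n :
  good ob itp (nth ([::], [::], [::]) (map rule_of (map eqn s)) n).
Proof.
elim: s n => [|x s IHs] [|n] //=; try by exists [::]; split; rewrite /= ?eqxx.
exact: good_holds (hintP x).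
Qed.

(** The reflection principle behind all diagrammatic proofs. *)
Lemma by_moves (s : seq hint) ml mr l r :
  agree (map rule_of (map eqn s)) ml mr l r -> holds l r.
Proof.
case/and5P=> tl tr /eqP es /eqP et.
case el: (replay _ _ _ _) => [d|] // /eqP er.
have [pl sl rl] := value_ok itpP tl; have [pr sr rr] := value_ok itpP tr.
have hg i : good ob itp (lookup (map rule_of (map eqn s)) i).
  case: i => [n|g c lf f]; [exact: nth_hints|exact: (good_slide itpP)].
have [_ _ a1 a2] := same_replay itpP hg el pl.
have [_ _ b1 b2] := same_replay itpP hg er pr.
rewrite /holds /value_of tl tr es et !eqxx; split=> //.
  by rewrite -sl -sr a1 b1 es.
by rewrite -rl -rr a2 b2 et.
Qed.

Lemma in_context post pre l r : holds l r ->
  [&& typed post, typed pre, src post == tgt l & src l == tgt pre] ->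
  holds (post ∘ l ∘ pre)%E (post ∘ r ∘ pre)%E.
Proof.
case=> /and4P[tl tr /eqP s /eqP t] e1 e2 /and4P[to tp so sp].
split; rewrite /value_of /= ?to ?tp ?tl ?tr -?s -?t ?so ?sp ?eqxx //.
  by rewrite -/(value_of l) e1.
by rewrite -/(value_of (rot l)) e2.
Qed.

(** Crossings are invertible.  An equation about two neighbouring strands is thereby
    transported to strands that are separated by others, once a crossing has
    moved the others out of the way. *)
Lemma cancel_crossing p u v l r : typed l -> typed r -> src l = src r ->
  tgt l = p ++ u ++ v -> tgt r = p ++ u ++ v ->
  holds ((Id p ⊗ Cross u v) ∘ l)%E ((Id p ⊗ Cross u v) ∘ r)%E -> holds l r.
Proof.
move=> tl tr s el er [_ e1 e2].
have hval e : typed e -> hom (V ob (src e)) (V ob (tgt e)) (value_of e).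
  move=> te; have [P E _] := value_ok itpP te.
  by rewrite /value_of -E; exact: (sem_hom itpP P).
split; first by rewrite tl tr s el er !eqxx.
  have hl := hval _ tl; have hr := hval _ tr; rewrite el in hl; rewrite er in hr.
  have [y hy [yb _]] := hom_brw' ob u v.
  move: e1 => /(congr1 (acomp (atens (ida ob p) y))).
  rewrite /value_of /= !wvalE -/(ida ob p) -/(brw ob u v) !acompA.
  have hp := hom_ida ob p; have hb := hom_brw ob u v.
  rewrite -(atens_comp hp hp hy hb) yb (acomp1x hp) -ida_cat.
  by rewrite (acomp1x hl) (acomp1x hr).
have tl' : typed (rot l) by rewrite rot_typed.
have tr' : typed (rot r) by rewrite rot_typed.
have hl := hval _ tl'; have hr := hval _ tr'.
rewrite !rot_src el er !rot_word_cat in hl hr.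
have [y hy [_ by_]] := hom_brw' ob (rot_word u) (rot_word v).
move: e2 => /(congr1 (fun x => acomp x (atens y (ida ob (rot_word p))))).
rewrite /value_of /= !wvalE -/(ida ob (rot_word p)).
rewrite -/(brw ob (rot_word u) (rot_word v)) -!acompA.
have hp := hom_ida ob (rot_word p); have hb := hom_brw ob (rot_word u) (rot_word v).
rewrite -(atens_comp hb hy hp hp) by_ (acomp1x hp) -ida_cat.
by rewrite (acompx1 hl) (acompx1 hr).
Qed.

End Model.

Coercion use : holds >-> hint.

(** Proves [holds h l r] by moves that [find] proposes.  The scripts [hl] and [hr]
    list the equations to apply to [l] and to [r], in this order; [us]
    simplifies the diagrams after every step, and [as_] helps where an equation
    of the scripts does not match at once. *)
Ltac diagram_with us as_ hl hr :=
  lazymatch goal with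
  | |- @holds ?C ?h ?l ?r =>
    let us' := constr:(us : seq (hint h)) in
    let as' := constr:(as_ : seq (hint h)) in
    let hl' := constr:(hl : seq (hint h)) in
    let hr' := constr:(hr : seq (hint h)) in
    let v := eval vm_compute in
      (find (map (@eqn C h) us') (map (@eqn C h) as')
         (map (fun x => (@pick C h x, @eqn C h x)) hl')
         (map (fun x => (@pick C h x, @eqn C h x)) hr') l r) in
    lazymatch v with
    | Some (?ml, ?mr) =>
        apply (@by_moves C h (hl' ++ hr' ++ as' ++ us') ml mr l r);
        vm_cast_no_check (erefl true)
    end
  end.

(** Translation between equations of morphisms and equations of expressions.  The
    sources and targets in the data agree with those of the expressions only up
    to conversion, B1 (x) B2 being sometimes one letter and sometimes two; the
    rewriting rules are therefore used with explicit arguments. *)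
Ltac push_warr :=
  repeat match goal with
  | |- context [@warr ?C ?u ?v (@wtens _ ?a ?b ?c ?d ?f ?g)] =>
      rewrite (@warr_tens C a b c d f g : @warr C u v (@wtens C a b c d f g) = _)
  | |- context [@warr ?C ?u ?v (@wcomp _ ?a ?b ?c ?f ?g)] =>
      rewrite (@warr_comp C a b c f g : @warr C u v (@wcomp C a b c f g) = _)
  | |- context [@warr ?C ?u ?v (wbraid ?a ?b)] =>
      rewrite (warr_braid a b : @warr C u v (wbraid a b) = _)
  | |- context [@warr ?C ?u ?v (wid ?a)] =>
      rewrite (warr_id a : @warr C u v (wid a) = _)
  | |- context [@warr ?C ?u ?v (group_dom ?f)] =>
      rewrite (warr_group_dom f : @warr C u v (group_dom f) = _)
  | |- context [@warr ?C ?u ?v (group_cod ?f)] =>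
      rewrite (warr_group_cod f : @warr C u v (group_cod f) = _)
  end.
Ltac from_eq E :=
  have := congr1 (@warr _ _ _) E; push_warr; rewrite /=; push_warr;
  rewrite /value_of /= ?acompA ?atensA;
  let F := fresh in move=> F; exact F.
Ltac from_data H1 H2 := split; [by []|from_eq H1|from_eq H2].
Ltac to_eq E :=
  apply: warr_inj; move: E; rewrite /value_of /=; push_warr; rewrite /=; push_warr;
  rewrite /= ?acompA ?atensA;
  let F := fresh in move=> F; exact F.
Ltac of_holds p := let E := fresh in case: p => _ E _; to_eq E.
Ltac of_dual p := let E := fresh in case: p => _ _ E; to_eq E.

Section Theory.
Local Notation m1 := (Box bm1). Local Notation η1 := (Box bη1).
Local Notation Δ1 := (Box bΔ1). Local Notation ε1 := (Box bε1).
Local Notation m2 := (Box bm2). Local Notation η2 := (Box bη2).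
Local Notation Δ2 := (Box bΔ2). Local Notation ε2 := (Box bε2).
Local Notation μl := (Box bμl). Local Notation μr := (Box bμr).
Local Notation νl := (Box bνl). Local Notation νr := (Box bνr).
Local Notation ρ := (Box bρ). Local Notation σ := (Box bσ). Local Notation α := (Box bα).
Local Notation β := (Box bβ). Local Notation λ := (Box bλ). Local Notation ζ := (Box bζ).
Local Notation φ12 := (Box bφ12). Local Notation φ21 := (Box bφ21).
Local Notation σhat := (Box bσhat). Local Notation ρhat := (Box bρhat).
Local Notation κ := (Box bκ). Local Notation ω := (Box bω).
Local Notation T1 := (Box bT1). Local Notation T2 := (Box bT2).
Local Notation T := (Box bT). Local Notation V1 := (Box bV1).
Local Notation V := (Box bV). Local Notation m := (Box bm). Local Notation Δ := (Box bΔ).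
Local Notation id1 := (Id [:: L1]). Local Notation id2 := (Id [:: L2]).
Local Notation id12 := (Id [:: L1; L2]). Local Notation idI := (Id [::]).
Local Notation Ψ11 := (Ψ [:: L1] [:: L1])%E. Local Notation Ψ12 := (Ψ [:: L1] [:: L2])%E.
Local Notation Ψ21 := (Ψ [:: L2] [:: L1])%E. Local Notation Ψ22 := (Ψ [:: L2] [:: L2])%E.
Local Notation Θ := (Ψ [:: L1; L2] [:: L1; L2])%E.
Local Open Scope expr_scope.
Variables (C : strict_braided_category) (h : structure_data C).
Local Notation "l ≡ r" := (holds h l r) (at level 70).
Local Notation "⟪⟫" := (@nil (hint h)).
Local Notation "⟪ a ; .. ; b ⟫" :=
  (@cons (hint h) (a : hint h) .. (@cons (hint h) (b : hint h) nil) ..).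
Let both l r (p : l ≡ r) : seq (hint h) := ⟪p; dual p⟫.

(** * Definitions of the composites *)

Ltac compare_values := push_warr; by rewrite /= ?acompA ?atensA.

Lemma α_def : α ≡ m2 ∘ (μr ⊗ id2).
Proof. split=> //; rewrite /value_of /= /Defs.α /Defs.ζ; compare_values. Qed.

Lemma λ_def : λ ≡ m1 ∘ (id1 ⊗ μl).
Proof. split=> //; rewrite /value_of /= /Defs.λ /Defs.β; compare_values. Qed.

Lemma φ12_def : φ12 ≡ (m2 ⊗ m1) ∘ (id2 ⊗ Ψ12 ⊗ id1) ∘ (νl ⊗ νr).
Proof. split=> //; rewrite /value_of /= /Defs.φ12 /Defs.φ21; compare_values. Qed.

Lemma σhat_def : σhat ≡ (σ ⊗ α) ∘ (id2 ⊗ Ψ22 ⊗ id12) ∘ (Δ2 ⊗ β).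
Proof. split=> //; rewrite /value_of /= /Defs.σhat /Defs.ρhat; compare_values. Qed.

Lemma κ_def : κ ≡ m1 ∘ (m1 ⊗ σ) ∘ (id1 ⊗ φ21 ⊗ id2).
Proof. split=> //; rewrite /value_of /= /Defs.κ /Defs.ω; compare_values. Qed.

Lemma T1_def : T1 ≡ (id1 ⊗ μr) ∘ (Ψ21 ⊗ id1) ∘ (id2 ⊗ Δ1).
Proof. split=> //; rewrite /value_of /= /T1_of /V1_of; compare_values. Qed.

Lemma T2_def : T2 ≡ (id2 ⊗ α) ∘ (Ψ22 ⊗ id12) ∘ (id2 ⊗ β).
Proof. split=> //; rewrite /value_of /= /T2_of /V2_of; compare_values. Qed.

Lemma T_def : T ≡ (id1 ⊗ T2) ∘ (T1 ⊗ id2).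
Proof. split=> //; rewrite /value_of /= /T_of /V_of; compare_values. Qed.

Lemma m_def : m ≡ (m1 ⊗ id2) ∘ (m1 ⊗ σhat) ∘ (id1 ⊗ φ21 ⊗ id2).
Proof. split=> //; rewrite /value_of /= /cross_mul /cross_comul; compare_values. Qed.

Let ζ_def := dual α_def.
Let β_def := dual λ_def.
Let φ21_def := dual φ12_def.
Let ρhat_def := dual σhat_def.
Let ω_def := dual κ_def.
Let V1_def := dual T1_def.
Let Δ_def := dual m_def.

(** * Units and counits *)

(** What both a Hopf datum and a cocycle cross product bialgebra assume; the
    remaining (co)unit laws of a Hopf datum follow from it in a cross product
    bialgebra. *)
Record unital0 : Prop := Unital0 {
  u_algebra : is_algebra (Defs.m1 h) (Defs.η1 h);
  u_coalgebra : is_coalgebra (Defs.Δ2 h) (Defs.ε2 h);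
  u_U1 : unital_U1 h;
  u_U2 : unital_U2 h;
  u_U3 : unital_U3 h
}.

Section Unital0.
Hypothesis U : unital0.
Let H1 := u_algebra U.
Let H2 := u_coalgebra U.
Let U1 := u_U1 U.
Let U2 := u_U2 U.

Lemma m1_assoc : m1 ∘ (m1 ⊗ id1) ≡ m1 ∘ (id1 ⊗ m1).
Proof. case: H1 => E _ _; case: H2 => E' _ _; from_data E (esym E'). Qed.

Lemma m1_unitl : m1 ∘ (η1 ⊗ id1) ≡ id1.
Proof. case: H1 => _ E _; case: H2 => _ _ E'; from_data E E'. Qed.

Lemma m1_unitr : m1 ∘ (id1 ⊗ η1) ≡ id1.
Proof. case: H1 => _ _ E; case: H2 => _ E' _; from_data E E'. Qed.

Lemma Δ1_η1 : Δ1 ∘ η1 ≡ η1 ⊗ η1.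
Proof. from_data (Defs.Δ1_η1 U1) (ε2_m2 U1). Qed.

Lemma Δ1_counitr : (id1 ⊗ ε1) ∘ Δ1 ≡ id1.
Proof. from_data (Defs.Δ1_counitr U1) (m2_unitl U1). Qed.

Lemma Δ1_counitl : (ε1 ⊗ id1) ∘ Δ1 ≡ id1.
Proof. from_data (Defs.Δ1_counitl U1) (m2_unitr U1). Qed.

Lemma μr_η2 : μr ∘ (η2 ⊗ id1) ≡ η2 ∘ ε1.
Proof. from_data (Defs.μr_η2 U2) (νl_ε1 U2). Qed.

Lemma ε2_μr : ε2 ∘ μr ≡ ε2 ⊗ ε1.
Proof. from_data (Defs.ε2_μr U2) (νl_η1 U2). Qed.

Lemma μl_η2 : μl ∘ (η2 ⊗ id1) ≡ id1.
Proof. from_data (Defs.μl_η2 U2) (νr_ε1 U2). Qed.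

Lemma μl_η1 : μl ∘ (id2 ⊗ η1) ≡ η1 ∘ ε2.
Proof. from_data (Defs.μl_η1 U2) (νr_ε2 U2). Qed.

Lemma ε1_μl : ε1 ∘ μl ≡ ε2 ⊗ ε1.
Proof. from_data (Defs.ε1_μl U2) (νr_η2 U2). Qed.

Lemma μr_η1 : μr ∘ (id2 ⊗ η1) ≡ id2.
Proof. from_data (Defs.μr_η1 (u_U3 U)) (νl_ε2 (u_U3 U)). Qed.

Definition associativities : seq (hint h) :=
  ⟪m1_assoc; back m1_assoc; dual m1_assoc; back_dual m1_assoc⟫.

(* Iterated products of B1 and coproducts of B2 are nested to the right. *)
Definition units0 : seq (hint h) :=
  both m1_unitl ++ both m1_unitr ++ both Δ1_η1 ++ both Δ1_counitr ++ both Δ1_counitl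
  ++ both μr_η2 ++ both ε2_μr ++ both μl_η2 ++ both μl_η1 ++ both ε1_μl ++ both μr_η1
  ++ ⟪m1_assoc; back_dual m1_assoc⟫.
End Unital0.

Record unital : Prop := Unital {
  u_unital0 :> unital0;
  u_augmentation : is_augmentation (Defs.m1 h) (Defs.η1 h) (Defs.ε1 h);
  u_coaugmentation : is_coaugmentation (Defs.Δ2 h) (Defs.ε2 h) (Defs.η2 h);
  u_σρ : unital_σρ h
}.

Section Unital.
Hypothesis U : unital.
Let Uσρ := u_σρ U.

Lemma ε1_m1 : ε1 ∘ m1 ≡ ε1 ⊗ ε1.
Proof. case: (u_augmentation U) => E _; case: (u_coaugmentation U) => E' _; from_data E E'. Qed.

Lemma ε1_η1 : ε1 ∘ η1 ≡ idI.
Proof. case: (u_augmentation U) => _ E; case: (u_coaugmentation U) => _ E'; from_data E E'. Qed.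

Lemma σ_unitl : σ ∘ (η2 ⊗ id2) ≡ η1 ∘ ε2.
Proof. from_data (Defs.σ_unitl Uσρ) (ρ_counitr Uσρ). Qed.

Lemma σ_unitr : σ ∘ (id2 ⊗ η2) ≡ η1 ∘ ε2.
Proof. from_data (Defs.σ_unitr Uσρ) (ρ_counitl Uσρ). Qed.

Lemma ε1_σ : ε1 ∘ σ ≡ ε2 ⊗ ε2.
Proof. from_data (Defs.ε1_σ Uσρ) (ρ_η2 Uσρ). Qed.

(* The tables of simplifications grow with the unit laws of the composites. *)
Definition units1 : seq (hint h) :=
  units0 U ++ both ε1_m1 ++ both ε1_η1 ++ both σ_unitl ++ both σ_unitr ++ both ε1_σ.
Tactic Notation "diagram0" constr(hl) constr(hr) :=
  diagram_with units1 (associativities U) hl hr.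

Lemma φ12_unitr : φ12 ∘ (id1 ⊗ η2) ≡ νl.
Proof. diagram0 ⟪φ12_def⟫ ⟪⟫. Qed.

Lemma φ12_unitl : φ12 ∘ (η1 ⊗ id2) ≡ νr.
Proof. diagram0 ⟪φ12_def⟫ ⟪⟫. Qed.

Lemma φ12_counitl : (ε2 ⊗ id1) ∘ φ12 ≡ id1 ⊗ ε2.
Proof. diagram0 ⟪φ12_def⟫ ⟪⟫. Qed.

Lemma φ12_counitr : (id2 ⊗ ε1) ∘ φ12 ≡ ε1 ⊗ id2.
Proof. diagram0 ⟪φ12_def⟫ ⟪⟫. Qed.

Lemma ρhat_unitr : ρhat ∘ (id1 ⊗ η2) ≡ Δ1.
Proof. diagram0 ⟪ρhat_def; λ_def; ζ_def⟫ ⟪⟫. Qed.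

Lemma ρhat_unitl : ρhat ∘ (η1 ⊗ id2) ≡ ρ.
Proof. diagram0 ⟪ρhat_def; λ_def; ζ_def⟫ ⟪⟫. Qed.

Lemma ρhat_counitl : (ε1 ⊗ id1) ∘ ρhat ≡ id1 ⊗ ε2.
Proof. diagram0 ⟪ρhat_def; λ_def; ζ_def⟫ ⟪⟫. Qed.

Lemma ρhat_counitr : (id1 ⊗ ε1) ∘ ρhat ≡ id1 ⊗ ε2.
Proof. diagram0 ⟪ρhat_def; λ_def; ζ_def⟫ ⟪⟫. Qed.

Lemma λ_unitr : λ ∘ (id1 ⊗ id2 ⊗ η1) ≡ id1 ⊗ ε2.
Proof. diagram0 ⟪λ_def⟫ ⟪⟫. Qed.

Lemma κ_unitl : κ ∘ (η1 ⊗ id2 ⊗ id12) ≡ m1 ∘ (id1 ⊗ σ) ∘ (φ21 ⊗ id2).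
Proof. diagram0 ⟪κ_def⟫ ⟪⟫. Qed.

Definition units2 := units1 ++ both φ12_unitr ++ both φ12_unitl ++ both φ12_counitl
  ++ both φ12_counitr ++ both ρhat_unitr ++ both ρhat_unitl ++ both ρhat_counitl
  ++ both ρhat_counitr ++ both λ_unitr ++ both κ_unitl.
Tactic Notation "diagram1" constr(hl) constr(hr) :=
  diagram_with units2 (associativities U) hl hr.

Lemma Δ_unitl : Δ ∘ (η1 ⊗ id2) ≡ ω.
Proof. diagram1 ⟪Δ_def⟫ ⟪ω_def⟫. Qed.

Lemma Δ_counit2 : (id12 ⊗ ε1 ⊗ id2) ∘ Δ ≡ id1 ⊗ Δ2.
Proof. diagram1 ⟪Δ_def⟫ ⟪⟫. Qed.

Lemma Δ_counit1 : (ε1 ⊗ id2 ⊗ id12) ∘ Δ ≡ (φ12 ⊗ id2) ∘ (id1 ⊗ Δ2).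
Proof. diagram1 ⟪Δ_def⟫ ⟪⟫. Qed.

Definition units : seq (hint h) :=
  units2 ++ both Δ_unitl ++ both Δ_counit2 ++ both Δ_counit1.
Tactic Notation "diagram2" constr(hl) constr(hr) :=
  diagram_with units (associativities U) hl hr.

Lemma m_unitl : m ∘ (η1 ⊗ η2 ⊗ id12) ≡ id12.
Proof. diagram2 ⟪⟫ ⟪⟫. Qed.

Lemma m_unitr : m ∘ (id12 ⊗ η1 ⊗ η2) ≡ id12.
Proof. diagram2 ⟪⟫ ⟪⟫. Qed.

Lemma ε_m : (ε1 ⊗ ε2) ∘ m ≡ ε1 ⊗ ε2 ⊗ ε1 ⊗ ε2.
Proof. diagram2 ⟪κ_def⟫ ⟪⟫. Qed.

Lemma ε_η : (ε1 ⊗ ε2) ∘ (η1 ⊗ η2) ≡ idI.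
Proof. diagram2 ⟪⟫ ⟪⟫. Qed.

Lemma φ21_σhat : φ21 ≡ (m1 ⊗ id2) ∘ (id1 ⊗ σhat) ∘ (φ21 ⊗ η2).
Proof. diagram2 ⟪⟫ ⟪⟫. Qed.
End Unital.

(** * The strong conditions (S5) and (S6) *)

Section Strong5.
Hypothesis HS : strong_conditions h.

Lemma S5 : (σ ⊗ id1) ∘ (id2 ⊗ νl) ≡ η1 ∘ ε2 ⊗ id1.
Proof. from_data (strong5 HS) (strong6 HS). Qed.

(** (S5) still applies if σ and νl are separated by other strands; [w] is concrete
    because the crossings are cancelled by computation. *)
Lemma S5_past w :
  w \in [:: [:: L1]; [:: L2]; [:: L1; L2]; [:: L1; L2; L1]; [:: L2; L1; L2]] ->
  (σ ⊗ Id w ⊗ id1) ∘ (id2 ⊗ Ψ w [:: L2] ⊗ id1) ∘ (id2 ⊗ Id w ⊗ νl)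
  ≡ η1 ∘ ε2 ⊗ Id w ⊗ id1.
Proof.
rewrite !inE => /or4P[||| /orP[]] /eqP ->;
  apply: (@cancel_crossing _ _ [:: L1] _ [:: L1]) => //;
  diagram_with (@nil (hint h)) (@nil (hint h)) ⟪S5⟫ ⟪⟫.
Qed.
End Strong5.

(** * Strong Hopf data *)

Section Strong.
Hypothesis H : strong_hopf_datum h.
Let H0 := shd_hopf_datum H.
Let HC := hd_compatibility H0.
Let HS := shd_strong H.

Lemma strong_unital : unital.
Proof.
case: H0 => a b c d [_ e] [_ f] g i j _.
by split=> //; split=> //; split.
Qed.

Let U := strong_unital.

Lemma μr_assoc : μr ∘ (μr ⊗ id1) ≡ μr ∘ (id2 ⊗ m1).
Proof. from_data (proj1 (hd_module H0)) (esym (proj1 (hd_comodule H0))). Qed.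

Lemma m2_wassoc : m2 ∘ (m2 ⊗ id2) ≡ m2 ∘ (μr ⊗ id2) ∘ (id2 ⊗ σhat).
Proof. from_data (weak_assoc_m2 HC) (weak_coassoc_Δ1 HC). Qed.

Lemma μl_wassoc :
  m1 ∘ (id1 ⊗ μl) ∘ (σhat ⊗ id1)
  ≡ m1 ∘ (id1 ⊗ σ) ∘ (φ21 ⊗ id2) ∘ (id2 ⊗ φ21).
Proof. from_data (weak_assoc_μl HC) (weak_coassoc_νr HC). Qed.

Lemma μl_m1 : μl ∘ (id2 ⊗ m1) ≡ m1 ∘ (id1 ⊗ μl) ∘ (φ21 ⊗ id1).
Proof. from_data (module_algebra_μl HC) (comodule_coalgebra_νr HC). Qed.

Lemma μr_m2 : μr ∘ (m2 ⊗ id1) ≡ m2 ∘ (μr ⊗ id2) ∘ (id2 ⊗ φ21).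
Proof. from_data (module_algebra_μr HC) (comodule_coalgebra_νl HC). Qed.

Lemma σ_cocycle :
  m1 ∘ (id1 ⊗ σ) ∘ (σhat ⊗ id2)
  ≡ m1 ∘ (id1 ⊗ σ) ∘ (φ21 ⊗ id2) ∘ (id2 ⊗ σhat).
Proof. from_data (cocycle_σ HC) (cycle_ρ HC). Qed.

Lemma Δ1_m1 : Δ1 ∘ m1 ≡ (λ ⊗ m1) ∘ (id12 ⊗ Ψ11 ⊗ id1) ∘ (ζ ⊗ Δ1).
Proof. from_data (algebra_coalgebra1 HC) (algebra_coalgebra2 HC). Qed.

Lemma Δ2_μr_twisted :
  Δ2 ∘ μr ≡ (α ⊗ μr) ∘ (id2 ⊗ Ψ [:: L2] [:: L1; L2] ⊗ id1) ∘ (Δ2 ⊗ ζ).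
Proof. from_data (module_coalgebra2 HC) (comodule_algebra1 HC). Qed.

Lemma ρhat_φ21 : ρhat ∘ φ21 ≡ (κ ⊗ λ) ∘ (id12 ⊗ Θ ⊗ id1) ∘ (ω ⊗ ζ).
Proof. from_data (module_coalgebra1 HC) (comodule_algebra2 HC). Qed.

Lemma φ12_φ21 : φ12 ∘ φ21 ≡ (α ⊗ λ) ∘ (id2 ⊗ Θ ⊗ id1) ∘ (β ⊗ ζ).
Proof. from_data (module_comodule HC) (module_comodule HC). Qed.

Lemma ρhat_σhat : ρhat ∘ σhat ≡ (κ ⊗ κ) ∘ (id12 ⊗ Θ ⊗ id12) ∘ (ω ⊗ ω).
Proof. from_data (cycle_cocycle HC) (cycle_cocycle HC). Qed.

Lemma S1 : (μr ⊗ id1) ∘ (id2 ⊗ Ψ11) ∘ (νl ⊗ id1) ≡ νl ⊗ ε1.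
Proof. from_data (strong1 HS) (strong2 HS). Qed.

Lemma S4 :
  (id1 ⊗ μr) ∘ (Ψ21 ⊗ μl) ∘ (id2 ⊗ Ψ21 ⊗ id1) ∘ (id2 ⊗ id2 ⊗ ρ)
  ≡ η1 ⊗ id2 ⊗ ε2 ⊗ ε2.
Proof. from_data (strong4 HS) (strong3 HS). Qed.

Tactic Notation "diagram" constr(hl) constr(hr) :=
  diagram_with (units U) (associativities U) hl hr.
(* equality through an intermediate diagram; equality of composites of equal maps *)
Tactic Notation "diagram_via" constr(mid) constr(ll) constr(lm) constr(rm) constr(rr) :=
  apply: (@holds_trans _ _ _ mid); [diagram ll lm|diagram rm rr].
Tactic Notation "diagram_from" constr(E) constr(post) constr(pre) :=
  refine (holds_trans _
    (holds_trans (in_context (post := post) (pre := pre) E (erefl true)) _));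
  [diagram ⟪⟫ ⟪⟫|diagram ⟪⟫ ⟪⟫].

Definition S7_lhs :=
  (id1 ⊗ μr ∘ (id2 ⊗ μl) ⊗ id1 ⊗ id1) ∘ (id1 ⊗ id2 ⊗ id2 ⊗ Ψ11 ⊗ id1)
    ∘ (Ψ21 ⊗ νl ⊗ id1 ⊗ id1)
    ∘ ((id2 ⊗ Ψ11 ⊗ id1 ⊗ id1) ∘ (id2 ⊗ id1 ⊗ Δ1 ⊗ id1) ∘ (id2 ⊗ id1 ⊗ ρ)).
Definition S7_rhs :=
  (id1 ⊗ μr ⊗ id1 ⊗ id1) ∘ (Ψ21 ⊗ Ψ11 ⊗ id1)
    ∘ ((id2 ⊗ Ψ11 ⊗ id1 ⊗ id1) ∘ (id2 ⊗ id1 ⊗ Δ1 ⊗ id1) ∘ (id2 ⊗ id1 ⊗ ρ)).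
(* The duals of the two sides of (S7) are those of (S8) only up to interchange. *)
Lemma S7 : S7_lhs ≡ S7_rhs.
Proof.
have L : rot S7_lhs ≡ (σ ∘ (id2 ⊗ m2) ⊗ id2 ⊗ id1) ∘ (id2 ⊗ id2 ⊗ Ψ22 ⊗ id1)
    ∘ (id2 ⊗ id2 ⊗ μr ⊗ Ψ12) ∘ (id2 ⊗ Ψ22 ⊗ id1 ⊗ id1 ⊗ id2)
    ∘ (id2 ⊗ id2 ⊗ νr ⊗ id1 ⊗ id2) ∘ (id2 ⊗ id2 ⊗ νl ⊗ id2).
  diagram ⟪⟫ ⟪⟫.
have R : rot S7_rhs ≡ (σ ∘ (id2 ⊗ m2) ⊗ id2 ⊗ id1) ∘ (id2 ⊗ id2 ⊗ Ψ22 ⊗ id1)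
    ∘ (id2 ⊗ Ψ22 ⊗ Ψ12) ∘ (id2 ⊗ id2 ⊗ νl ⊗ id2).
  diagram ⟪⟫ ⟪⟫.
have E := strong7 HS; have E' := strong8 HS.
rewrite /Defs.ξ in E; rewrite /Defs.χ in E'.
split; [by []|rewrite /S7_lhs /S7_rhs; from_eq E|].
by case: L R => _ -> _ [_ -> _]; from_eq E'.
Qed.

(** * What a right action sees *)

(** The last output of [f], a strand of B1, acts on an additional strand of B2 that
    passes over the other outputs [w].  By (S2) and (S4), the duals of (S1) and
    (S3), νl and ρ become trivial when they are observed in this way.  Most
    axioms of a Hopf datum thereby lose their correction terms: ρhat is seen
    as Δ1, and the weak coassociativity of Δ1 as coassociativity. *)
Definition act (w : word) (f : expr) : expr :=
  (Id w ⊗ μr) ∘ (Ψ [:: L2] w ⊗ id1) ∘ (id2 ⊗ f).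

Lemma S4_unit : act [:: L1] ρ ≡ η1 ⊗ id2 ⊗ ε2.
Proof. diagram_from S4 (Id [:: L1; L2]) (id2 ⊗ η2 ⊗ id2). Qed.

Lemma Δ2_μr : Δ2 ∘ μr ≡ (μr ⊗ μr) ∘ (id2 ⊗ Ψ21 ⊗ id1) ∘ (Δ2 ⊗ Δ1).
Proof. diagram ⟪Δ2_μr_twisted; α_def; ζ_def; dual S1⟫ ⟪⟫. Qed.

Lemma Δ1_coassoc_act :
  act [:: L1; L1] ((Δ1 ⊗ id1) ∘ Δ1)
  ≡ act [:: L1; L1] ((id1 ⊗ Δ1) ∘ Δ1).
Proof. diagram ⟪⟫ ⟪dual m2_wassoc; dual S1⟫. Qed.

Lemma νl_Δ1_act :
  act [:: L2; L1] ((id2 ⊗ Δ1) ∘ νl)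
  ≡ act [:: L2; L1] ((νl ⊗ id1) ∘ Δ1).
Proof. diagram ⟪dual μr_m2; dual S1⟫ ⟪⟫. Qed.

Lemma ρhat_act :
  act [:: L1] ρhat ≡ act [:: L1] (Δ1 ⊗ ε2).
Proof. diagram ⟪ρhat_def; ζ_def; back μr_assoc; S4_unit⟫ ⟪⟫. Qed.

Lemma φ12_act :
  act [:: L2] φ12 ≡ (id2 ⊗ μr) ∘ (Ψ22 ⊗ id1) ∘ (μr ⊗ νr).
Proof. diagram ⟪φ12_def; back μr_assoc; dual S1⟫ ⟪⟫. Qed.

Lemma νr_Δ2_act :
  act [:: L2; L2] ((Δ2 ⊗ id1) ∘ νr)
  ≡ (id2 ⊗ id2 ⊗ μr ∘ (μr ⊗ id1)) ∘ (id2 ⊗ Ψ22 ⊗ id1 ⊗ id1) ∘ (Ψ22 ⊗ Ψ12 ⊗ id1)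
    ∘ (id2 ⊗ (νr ⊗ νr) ∘ Δ2).
Proof. diagram ⟪dual μl_m1; φ12_act⟫ ⟪⟫. Qed.

(** The weak coassociativity of νr and the cycle law of ρ, observed through the
    action, where φ12 and ρhat simplify. *)
Lemma νr_coassoc_act :
  act [:: L2; L1] ((id2 ⊗ Δ1) ∘ νr)
  ≡ act [:: L2; L1] ((νr ⊗ id1) ∘ νr).
Proof.
diagram_via (act [:: L2; L1] ((id2 ⊗ ρhat) ∘ (νr ⊗ id2) ∘ Δ2))
  ⟪⟫ ⟪ρhat_act⟫ ⟪dual μl_wassoc; φ12_act; S4_unit⟫ ⟪⟫.
Qed.

Lemma ρ_coassoc_act :
  act [:: L1; L1] ((id1 ⊗ Δ1) ∘ ρ)
  ≡ act [:: L1; L1] ((ρ ⊗ id1) ∘ νr).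
Proof.
diagram_via (act [:: L1; L1] ((id1 ⊗ ρhat) ∘ (ρ ⊗ id2) ∘ Δ2))
  ⟪⟫ ⟪ρhat_act⟫ ⟪dual σ_cocycle; φ12_act; S4_unit⟫ ⟪⟫.
Qed.

Lemma Δ1_m1_act :
  act [:: L1] (Δ1 ∘ m1) ≡ (m1 ⊗ id2) ∘ (id1 ⊗ act [:: L1] Δ1) ∘ (act [:: L1] Δ1 ⊗ id1).
Proof. diagram ⟪Δ1_m1; λ_def; ζ_def; back μr_assoc; dual S1⟫ ⟪⟫. Qed.

Lemma φ12_Δ1_act :
  act [:: L2; L1] ((id2 ⊗ Δ1) ∘ φ12)
  ≡ (φ12 ⊗ μr) ∘ (id1 ⊗ Ψ22 ⊗ id1) ∘ (id1 ⊗ μr ⊗ νr) ∘ (Ψ21 ⊗ id1 ⊗ id2) ∘ (id2 ⊗ Δ1 ⊗ id2).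
Proof. diagram ⟪φ12_def; Δ1_m1_act; νl_Δ1_act; νr_coassoc_act⟫ ⟪φ12_def⟫. Qed.

(** * The operator T and associativity of the product *)

Lemma T1_m1 : T1 ∘ (id2 ⊗ m1) ≡ (m1 ⊗ id2) ∘ (id1 ⊗ T1) ∘ (T1 ⊗ id1).
Proof. diagram ⟪T1_def; Δ1_m1_act⟫ ⟪T1_def; T1_def⟫. Qed.

(** Since the action is compatible with coproducts, T1 and T2 iterate along Δ2. *)
Lemma Δ2_T1 : (id1 ⊗ Δ2) ∘ T1 ≡ (T1 ⊗ id2) ∘ (id2 ⊗ T1) ∘ (Δ2 ⊗ id1).
Proof. diagram ⟪T1_def; Δ2_μr⟫ ⟪T1_def; T1_def; Δ1_coassoc_act⟫. Qed.

Lemma Δ2_T2 : (id2 ⊗ Δ2) ∘ T2 ≡ (T2 ⊗ id2) ∘ (id2 ⊗ T2) ∘ (Δ2 ⊗ id2).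
Proof.
diagram ⟪T2_def; α_def; dual Δ1_m1; Δ2_μr; α_def; β_def; β_def; νr_coassoc_act⟫
  ⟪T2_def; T2_def; β_def; α_def; β_def; α_def; νr_Δ2_act⟫.
Qed.

(** B2 is a right module over B1 (x) B2. *)
Lemma α_m : α ∘ (id2 ⊗ m) ≡ α ∘ (α ⊗ id12).
Proof.
diagram ⟪m_def; α_def; back μr_assoc; back μr_assoc; back m2_wassoc⟫ ⟪α_def; α_def; μr_m2⟫.
Qed.

Lemma Δ2_α : Δ2 ∘ α ≡ (α ⊗ id2) ∘ (id2 ⊗ T) ∘ (Δ2 ⊗ id12).
Proof.
diagram ⟪α_def; dual Δ1_m1; Δ2_μr; α_def; β_def⟫ ⟪T_def; T1_def; T2_def; α_def; α_def; β_def⟫.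
Qed.

Lemma ω_act :
  (id12 ⊗ α) ∘ (Ψ [:: L2] [:: L1; L2] ⊗ id12) ∘ (id2 ⊗ ω) ≡ η1 ⊗ T2.
Proof. diagram ⟪ω_def; α_def; φ12_act; S4_unit⟫ ⟪T2_def; β_def; α_def⟫. Qed.

(** This is the meaning of T: of the coproduct of B1 (x) B2, the right leg acts on
    B2. *)
Lemma Δ_act :
  (id12 ⊗ α) ∘ (Ψ [:: L2] [:: L1; L2] ⊗ id12) ∘ (id2 ⊗ Δ) ≡ T.
Proof.
diagram ⟪Δ_def; α_def; φ12_act; ρhat_act⟫ ⟪T_def; T1_def; T2_def; β_def; α_def⟫.
Qed.

Lemma ω_T :
  (id12 ⊗ T) ∘ (Ψ [:: L2] [:: L1; L2] ⊗ id12) ∘ (id2 ⊗ ω) ≡ (ω ⊗ id2) ∘ T2.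
Proof.
diagram ⟪ω_def; T_def; T1_def; T2_def; α_def; β_def; φ12_Δ1_act; ρ_coassoc_act⟫
  ⟪T2_def; ω_def; α_def; β_def; νr_Δ2_act; νr_Δ2_act⟫.
Qed.

Lemma β_T : (id2 ⊗ T) ∘ (Ψ22 ⊗ id12) ∘ (id2 ⊗ β) ≡ (β ⊗ id2) ∘ T2.
Proof.
diagram ⟪β_def; T_def; T2_def; T1_def; α_def; β_def; νr_coassoc_act⟫
  ⟪T2_def; α_def; β_def; β_def; νr_Δ2_act⟫.
Qed.

(** After Δ2 and T, the maps φ21, σhat and the product only need a map to B1 that
    does not touch the last strand; so their B2-component is known once T is. *)
Lemma φ21_T : φ21 ≡ (μl ⊗ id2) ∘ (id2 ⊗ T1) ∘ (Δ2 ⊗ id1).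
Proof. diagram ⟪φ21_def⟫ ⟪T1_def⟫. Qed.

Lemma σhat_T : σhat ≡ (σ ⊗ id2) ∘ (id2 ⊗ T2) ∘ (Δ2 ⊗ id2).
Proof. diagram ⟪σhat_def⟫ ⟪T2_def⟫. Qed.

Lemma Δ2_φ21 : (id1 ⊗ Δ2) ∘ φ21 ≡ (φ21 ⊗ id2) ∘ (id2 ⊗ T1) ∘ (Δ2 ⊗ id1).
Proof. diagram ⟪φ21_T; Δ2_T1⟫ ⟪φ21_T⟫. Qed.

Lemma Δ2_σhat : (id1 ⊗ Δ2) ∘ σhat ≡ (σhat ⊗ id2) ∘ (id2 ⊗ T2) ∘ (Δ2 ⊗ id2).
Proof. diagram ⟪σhat_T; Δ2_T2⟫ ⟪σhat_T⟫. Qed.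

Lemma m_T : m ≡ (κ ⊗ id2) ∘ (id12 ⊗ T) ∘ (id1 ⊗ Δ2 ⊗ id12).
Proof. diagram ⟪m_def; σhat_T; Δ2_φ21⟫ ⟪κ_def; T_def⟫. Qed.

Lemma m_unit_T :
  (m1 ⊗ id2) ∘ (id1 ⊗ σhat) ∘ (φ21 ⊗ id2)
  ≡ (m1 ∘ (id1 ⊗ σ) ∘ (φ21 ⊗ id2) ⊗ id2) ∘ (id2 ⊗ T) ∘ (Δ2 ⊗ id12).
Proof. diagram ⟪σhat_T; Δ2_φ21⟫ ⟪T_def⟫. Qed.

(** The laws saying that T respects φ21 and σhat come from the mixed compatibilities
    of the datum, observed through the action: this one from that for ρhat φ21,
    [T2_φ21] from that for φ12 φ21, [T2_σhat] from that for φ12 σhat, and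
    [T_σhat] from the cycle-cocycle compatibility. *)
Lemma Δ1_μl_act :
  act [:: L1] (Δ1 ∘ μl)
  ≡ (μl ⊗ μr) ∘ (id2 ⊗ Ψ21 ⊗ μl) ∘ (id2 ⊗ μr ⊗ Ψ21 ⊗ id1)
    ∘ (Ψ22 ⊗ Id [:: L1; L2; L1; L1]) ∘ (id2 ⊗ νr ⊗ id2 ⊗ Δ1) ∘ (id2 ⊗ Δ2 ⊗ id1).
Proof.
diagram_via (act [:: L1] (ρhat ∘ φ21)) ⟪⟫ ⟪ρhat_act⟫
  ⟪ρhat_φ21; λ_def; ζ_def; ω_def; back μr_assoc; φ12_act; S4_unit;
    S5_past HS (w := [:: L2; L1; L2]) isT⟫ ⟪⟫.
Qed.

Lemma T2_φ21 : T2 ∘ (μr ⊗ id2) ∘ (id2 ⊗ φ21) ≡ (μr ⊗ id2) ∘ (id2 ⊗ T1) ∘ (T2 ⊗ id1).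
Proof.
diagram_via ((id2 ⊗ m2) ∘ (act [:: L2] (φ12 ∘ φ21) ⊗ id2) ∘ (id2 ⊗ id2 ⊗ T1)
    ∘ (id2 ⊗ Δ2 ⊗ id1))
  ⟪T2_def; β_def; Δ2_φ21; α_def⟫ ⟪φ12_act⟫
  ⟪φ12_φ21; α_def; λ_def; ζ_def; back μr_assoc; β_def; T1_def; Δ1_coassoc_act;
    back νl_Δ1_act; back φ21_def; back μr_m2; dual S1⟫
  ⟪T2_def; β_def; T1_def; α_def⟫.
Qed.

Lemma T_φ21 : T ∘ (id2 ⊗ φ21) ≡ (φ21 ⊗ id2) ∘ (id2 ⊗ T1) ∘ (T2 ⊗ id1).
Proof.
diagram ⟪T_def; φ21_T; T1_def; T1_def; Δ1_μl_act; Δ1_coassoc_act; back φ21_def; T2_φ21;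
    T2_def; α_def; β_def; T1_def⟫
  ⟪T2_def; φ21_def; α_def; β_def; νr_Δ2_act; T1_def; Δ1_coassoc_act⟫.
Qed.

Lemma T2_σhat : T2 ∘ (μr ⊗ id2) ∘ (id2 ⊗ σhat) ≡ (m2 ⊗ id2) ∘ (id2 ⊗ T2) ∘ (T2 ⊗ id2).
Proof.
diagram_via ((id2 ⊗ m2) ∘ (act [:: L2] (φ12 ∘ σhat) ⊗ id2) ∘ (id2 ⊗ id2 ⊗ T2)
    ∘ (id2 ⊗ Δ2 ⊗ id2))
  ⟪T2_def; β_def; Δ2_σhat; α_def⟫ ⟪φ12_act⟫
  ⟪dual ρhat_φ21; α_def; ω_def; dual (S5_past HS (w := [:: L1; L2; L1]) isT);
    back β_def; back β_T; β_def; back m_T; back α_def; α_m⟫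
  ⟪T2_def; T2_def; β_def⟫.
Qed.

Lemma T2_m :
  T2 ∘ (μr ⊗ id2) ∘ (id2 ⊗ (m1 ⊗ id2) ∘ (id1 ⊗ σhat) ∘ (φ21 ⊗ id2))
  ≡ (α ⊗ id2) ∘ (id2 ⊗ T) ∘ (T2 ⊗ id12).
Proof. diagram ⟪back μr_assoc; T2_σhat; T2_φ21⟫ ⟪α_def; T_def⟫. Qed.

Lemma T_σhat : T ∘ (id2 ⊗ σhat) ≡ (σhat ⊗ id2) ∘ (id2 ⊗ T2) ∘ (T2 ⊗ id2).
Proof.
diagram_via ((id1 ⊗ T2) ∘ (act [:: L1] (ρhat ∘ σhat) ⊗ id2) ∘ (id2 ⊗ id2 ⊗ T2)
    ∘ (id2 ⊗ Δ2 ⊗ id2))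
  ⟪T_def; σhat_T; T1_def⟫ ⟪ρhat_act⟫
  ⟪ρhat_σhat; ω_def; κ_def; κ_def; back μr_assoc; φ12_act; S4_unit; back ω_T; back m_unit_T;
    T2_m; ω_T; ω_act; T2_def; β_def; α_def⟫
  ⟪σhat_T; T2_def; β_def; α_def; νr_Δ2_act⟫.
Qed.

(** Three laws make up the associativity of the product.  Both sides of each factor
    through T; as T is multiplicative, only the components in B1 have to be
    compared, and these are the module-algebra law of μl, its weak associativity
    and the cocycle law of σ. *)
Lemma φ21_m1 : φ21 ∘ (id2 ⊗ m1) ≡ (m1 ⊗ id2) ∘ (id1 ⊗ φ21) ∘ (φ21 ⊗ id1).
Proof. diagram ⟪φ21_T; T1_m1; μl_m1⟫ ⟪nth_hit 1 φ21_T; Δ2_φ21⟫. Qed.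

Lemma σhat_φ21 :
  (m1 ⊗ id2) ∘ (id1 ⊗ φ21) ∘ (σhat ⊗ id1)
  ≡ (m1 ⊗ id2) ∘ (id1 ⊗ σhat) ∘ (φ21 ⊗ id2) ∘ (id2 ⊗ φ21).
Proof. diagram ⟪φ21_T; Δ2_σhat; μl_wassoc⟫ ⟪m_unit_T; T_φ21⟫. Qed.

Lemma σhat_cocycle :
  (m1 ⊗ id2) ∘ (id1 ⊗ σhat) ∘ (σhat ⊗ id2)
  ≡ (m1 ⊗ id2) ∘ (id1 ⊗ σhat) ∘ (φ21 ⊗ id2) ∘ (id2 ⊗ σhat).
Proof. diagram ⟪nth_hit 1 σhat_T; Δ2_σhat; σ_cocycle⟫ ⟪m_unit_T; T_σhat⟫. Qed.

Lemma m_assoc : m ∘ (m ⊗ id12) ≡ m ∘ (id12 ⊗ m).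
Proof. diagram ⟪m_def; m_def; σhat_φ21; σhat_cocycle⟫ ⟪m_def; m_def; φ21_m1; φ21_m1⟫. Qed.

(** * Multiplicativity of the coproduct *)

Lemma S7_counit :
  (μr ∘ (id2 ⊗ μl) ⊗ id1 ⊗ id1) ∘ (id2 ⊗ id2 ⊗ Ψ11 ⊗ id1) ∘ (id2 ⊗ νl ⊗ ρ)
  ≡ (μr ⊗ id1 ⊗ id1) ∘ (id2 ⊗ Ψ11 ⊗ id1) ∘ (id2 ⊗ id1 ⊗ ρ).
Proof. diagram_from S7 (ε1 ⊗ Id [:: L2; L1; L1]) (Id [:: L2; L1; L2]). Qed.

(** If the first output of ρhat acts, instead of the last one, ρhat is again seen as
    Δ1, by (S7) and (S6). *)
Lemma ρhat_act_left : (μr ⊗ id1) ∘ (id2 ⊗ ρhat) ≡ (μr ⊗ id1) ∘ (id2 ⊗ Δ1 ⊗ ε2).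
Proof.
diagram ⟪ρhat_def; ζ_def; λ_def; back μr_assoc; S7_counit;
    dual (S5_past HS (w := [:: L2]) isT)⟫ ⟪⟫.
Qed.

Lemma ρhat_act_left_past_12 :
  (μr ⊗ id12 ⊗ id1) ∘ (id2 ⊗ Ψ [:: L1; L2] [:: L1] ⊗ id1) ∘ (id2 ⊗ id12 ⊗ ρhat)
  ≡ (μr ⊗ id12 ⊗ id1) ∘ (id2 ⊗ Ψ [:: L1; L2] [:: L1] ⊗ id1) ∘ (id2 ⊗ id12 ⊗ Δ1 ⊗ ε2).
Proof.
by apply: (@cancel_crossing _ _ [:: L2] [:: L1; L2] [:: L1]) => //;
  diagram ⟪ρhat_act_left⟫ ⟪⟫.
Qed.

(** V1 multiplies by the coaction of B1 from the left, which commutes with the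
    action from the right. *)
Lemma V1_α : V1 ∘ (id1 ⊗ α) ≡ (α ⊗ id1) ∘ (id2 ⊗ Ψ [:: L1] [:: L1; L2]) ∘ (V1 ⊗ id12).
Proof. diagram ⟪V1_def; α_def; dual Δ1_coassoc_act⟫ ⟪V1_def; α_def; dual νl_Δ1_act⟫. Qed.

(** The product recovered from its two components κ and α; dually, the coproduct
    of a (x) x is the product ζ(a) ω(x) in the tensor square of B1 (x) B2. *)
Lemma m_κα :
  m ≡ (κ ⊗ α) ∘ (id12 ⊗ Ψ [:: L2] [:: L1; L2] ⊗ id12) ∘ (id1 ⊗ Δ2 ⊗ Δ).
Proof. diagram ⟪m_T⟫ ⟪Δ_act⟫. Qed.

(** Dually, ζ is multiplicative: the case of two elements of B1. *)
Lemma Δ2_α_Δ :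
  Δ2 ∘ α ≡ (α ⊗ α) ∘ (id2 ⊗ Ψ [:: L2] [:: L1; L2] ⊗ id12) ∘ (Δ2 ⊗ Δ).
Proof. diagram ⟪Δ2_α⟫ ⟪Δ_act⟫. Qed.

Lemma φ12_V1 : φ12 ≡ (id2 ⊗ m1) ∘ (V1 ⊗ id1) ∘ (id1 ⊗ νr).
Proof. diagram ⟪φ12_def⟫ ⟪V1_def⟫. Qed.

Lemma φ12_σhat :
  φ12 ∘ σhat ≡ (m2 ⊗ κ) ∘ (id2 ⊗ Ψ [:: L1; L2] [:: L2] ⊗ id12) ∘ (β ⊗ β).
Proof.
diagram ⟪dual ρhat_φ21; α_def; ω_def; dual (S5_past HS (w := [:: L1; L2]) isT);
    back β_def⟫ ⟪⟫.
Qed.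

(** The special case of [φ12_m] in which the leftmost factor B1 is the unit. *)
Lemma φ12_m_unit :
  φ12 ∘ (m1 ⊗ id2) ∘ (id1 ⊗ σhat) ∘ (φ21 ⊗ id2) ≡ (α ⊗ κ) ∘ (id2 ⊗ Θ ⊗ id12) ∘ (β ⊗ Δ).
Proof.
diagram ⟪dual Δ2_φ21; φ12_σhat; V1_def; dual Δ1_coassoc_act; β_def; Δ2_φ21; back V1_def;
    κ_def; back φ12_V1; φ12_φ21; α_def; λ_def; ζ_def; T1_def; Δ1_coassoc_act; back νl_Δ1_act;
    β_def; back φ21_def; β_def; m2_wassoc; dual ρhat_act⟫
  ⟪Δ_def; α_def; ρhat_act_left_past_12; κ_def; φ12_V1; V1_def; φ21_m1; β_def⟫.
Qed.

(** Dually, the coproduct of φ21(x (x) a) is ω(x) ζ(a). *)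
Lemma φ12_m : φ12 ∘ m ≡ (α ⊗ κ) ∘ (id2 ⊗ Θ ⊗ id12) ∘ ((φ12 ⊗ id2) ∘ (id1 ⊗ Δ2) ⊗ Δ).
Proof.
diagram ⟪m_def; dual Δ2_φ21; φ12_m_unit; κ_def; β_def⟫ ⟪φ12_V1; back V1_α; κ_def⟫.
Qed.

(** Coassociativity, restricted to B2. *)
Lemma ω_coassoc : (id12 ⊗ Δ) ∘ ω ≡ (Δ ⊗ id12) ∘ ω.
Proof. diagram_from (dual m_assoc) (Id [:: L1; L2; L1; L2; L1; L2]) (η1 ⊗ id2). Qed.

Lemma ω_coassoc_counit :
  (id12 ⊗ (φ12 ⊗ id2) ∘ (id1 ⊗ Δ2)) ∘ ω ≡ (id1 ⊗ Δ2 ⊗ id12) ∘ ω.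
Proof. diagram_from ω_coassoc (id12 ⊗ ε1 ⊗ id2 ⊗ id12) id2. Qed.

Lemma Δ2_m : (id1 ⊗ Δ2) ∘ m ≡ (m ⊗ id2) ∘ (id12 ⊗ T) ∘ (id1 ⊗ Δ2 ⊗ id12).
Proof. diagram ⟪m_T; T_def; Δ2_T2; Δ2_T1⟫ ⟪m_T; T_def; T_def⟫. Qed.

Lemma ω_Δ2 : (ω ⊗ id2) ∘ Δ2 ≡ (id12 ⊗ id1 ⊗ Δ2) ∘ ω.
Proof. diagram ⟪ω_def⟫ ⟪ω_def⟫. Qed.

(** The case of two elements of B2: the coproduct of σhat(x (x) y) is ω(x) ω(y).
    The cycle-cocycle compatibility rewrites the ρhat σhat inside Δ σhat,
    [φ12_m] moves the remaining φ12, and the coassociativity of ω brings the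
    result into the form of [m_κα]. *)
Lemma Δ_σhat : Δ ∘ σhat ≡ (m ⊗ m) ∘ (id12 ⊗ Θ ⊗ id12) ∘ (ω ⊗ ω).
Proof.
diagram ⟪Δ_def; Δ2_σhat; ρhat_σhat; back ω_T; ω_Δ2; back m_T; Δ2_m; φ12_m; back Δ_act;
    back_dual m_assoc; back m_κα⟫
  ⟪m_κα; back ω_coassoc_counit; back ω_coassoc⟫.
Qed.

Lemma m_m1 : m ∘ (m1 ⊗ id2 ⊗ id12) ≡ (m1 ⊗ id2) ∘ (id1 ⊗ m).
Proof. diagram ⟪m_def⟫ ⟪m_def⟫. Qed.

Lemma m_φ21 : m ∘ ((m1 ⊗ id2) ∘ (id1 ⊗ φ21) ⊗ id12) ≡ m ∘ (id12 ⊗ m1 ⊗ id2).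
Proof. diagram_from m_assoc id12 (id12 ⊗ id1 ⊗ η2 ⊗ id12). Qed.

(** The coproduct of (a x)(b y) is ζ of products in B1, times ω and ζ of the parts
    of x b, times ω of products in B2; the dual of [Δ2_α_Δ], the dual of
    [φ12_m], and [Δ_σhat] turn it into ζ(a) ω(x) ζ(b) ω(y), which is
    the product of the two coproducts. *)
Lemma Δ_m : Δ ∘ m ≡ (m ⊗ m) ∘ (id12 ⊗ Θ ⊗ id12) ∘ (Δ ⊗ Δ).
Proof.
diagram ⟪m_def; dual m_κα; dual Δ2_α_Δ; dual Δ2_α_Δ; m_assoc; m_assoc; back_dual m_κα;
    Δ_σhat; back m_assoc; back m_m1; back_dual m_κα; dual φ12_m; m_assoc; m_m1⟫
  ⟪dual m_κα; dual m_κα; m_assoc; m_m1; back m_φ21; m_m1⟫.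
Qed.

(** The law that distinguishes cocycle cross product bialgebras; the cycle ρ
    in it disappears by (S6). *)
Lemma m2_νr :
  (m2 ⊗ id1) ∘ (id2 ⊗ νr) ≡ (m2 ⊗ id1) ∘ (μr ⊗ φ12) ∘ (id2 ⊗ (ρ ⊗ id2) ∘ Δ2).
Proof. diagram ⟪⟫ ⟪dual (S5 HS)⟫. Qed.

Lemma bowtie_strong : strong_cross_product_bialgebra (bowtie h).
Proof.
have algA : is_algebra (cp_m (bowtie h)) (cp_η (bowtie h)).
  by split; [of_holds m_assoc|of_holds (m_unitl U)|of_holds (m_unitr U)].
have coalgA : is_coalgebra (cp_Δ (bowtie h)) (cp_ε (bowtie h)).
  by split; [of_dual (holds_sym m_assoc)|of_dual (m_unitr U)|of_dual (m_unitl U)].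
split; last exact: HS.
split.
- split.
  + split=> //; [exact: hd_algebra H0|of_holds (φ21_σhat U)].
  + split=> //; [exact: hd_coalgebra H0|of_dual (φ21_σhat U)].
  split=> //; [of_holds Δ_m|of_dual (ε_m U)|].
  by split; [of_holds (ε_m U)|of_holds (ε_η U)].
- exact: (proj2 (hd_augmentation H0)).
- by [].
- by [].
- by [].
- by [].
- exact: hd_U1 H0.
- exact: hd_U2 H0.
- exact: u_U3 U.
- of_holds m2_νr.
- of_dual m2_νr.
Qed.
End Strong.

(** * From bialgebras to data *)

Section Converse.
Hypothesis K : strong_cross_product_bialgebra (bowtie h).
Let KC := scp_cocycle K.
Let KS := scp_strong K.
Let KA := cpb_algebra (ccp_bialgebra KC).
Let KD := cpb_coalgebra (ccp_bialgebra KC).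
Let KB := cpb_bialgebra (ccp_bialgebra KC).

Lemma cross_unital0 : unital0.
Proof.
split; [exact: cpa_algebra1 KA|exact: cpc_coalgebra2 KD|exact: ccp_U1 KC|
  exact: ccp_U2 KC|exact: ccp_U3 KC].
Qed.

Let U0 := cross_unital0.

Lemma cross_assoc : m ∘ (m ⊗ id12) ≡ m ∘ (id12 ⊗ m).
Proof.
case: (cpa_algebra KA) => E _ _; case: (cpc_coalgebra KD) => E' _ _; from_data E (esym E').
Qed.

Lemma cross_unitl : m ∘ (η1 ⊗ η2 ⊗ id12) ≡ id12.
Proof.
case: (cpa_algebra KA) => _ E _; case: (cpc_coalgebra KD) => _ _ E'; from_data E E'.
Qed.

Lemma cross_unitr : m ∘ (id12 ⊗ η1 ⊗ η2) ≡ id12.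
Proof.
case: (cpa_algebra KA) => _ _ E; case: (cpc_coalgebra KD) => _ E' _; from_data E E'.
Qed.

Lemma cross_counit_mul : (ε1 ⊗ ε2) ∘ m ≡ ε1 ⊗ ε2 ⊗ ε1 ⊗ ε2.
Proof. case: KB => _ _ _ E' [E _]; from_data E E'. Qed.

Lemma cross_comul_mul : Δ ∘ m ≡ (m ⊗ m) ∘ (id12 ⊗ Θ ⊗ id12) ∘ (Δ ⊗ Δ).
Proof. case: KB => _ _ E _ _; from_data E E. Qed.

Lemma cross_φ21 : φ21 ≡ (m1 ⊗ id2) ∘ (id1 ⊗ σhat) ∘ (φ21 ⊗ η2).
Proof. from_data (cpa_φ21 KA) (cpc_φ12 KD). Qed.

(** Normalization is one of a dual pair of equations; the other one, for B2, follows
    because the unit of the bialgebra has counit 1. *)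
Lemma cross_ε1_η1 : ε1 ∘ η1 ≡ idI.
Proof.
have E : value_of h (ε1 ∘ η1) = value_of h idI by from_eq (ccp_normalized KC).
split=> //; have F : value_of h ((ε1 ⊗ ε2) ∘ (η1 ⊗ η2)) = value_of h idI.
  case: KB => _ _ _ _ [_ F]; from_eq F.
have [_ G _] : (ε1 ⊗ ε2) ∘ (η1 ⊗ η2) ≡ (ε1 ∘ η1) ⊗ (ε2 ∘ η2).
  diagram_with (@nil (hint h)) (@nil (hint h)) (@nil (hint h)) (@nil (hint h)).
rewrite G in F; rewrite -[RHS]F.
by move: E; rewrite /value_of /= => ->; rewrite atens1x.
Qed.

Tactic Notation "diagram0" constr(hl) constr(hr) :=
  diagram_with (units0 U0 ++ both cross_ε1_η1) (associativities U0) hl hr.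

Lemma cross_φ21_unitl : φ21 ∘ (η2 ⊗ id1) ≡ id1 ⊗ η2.
Proof.
refine (holds_trans _
  (holds_trans (in_context (post := id12) (pre := id1 ⊗ η2) cross_unitl (erefl true)) _)).
  diagram0 ⟪⟫ ⟪m_def; back cross_φ21⟫.
diagram0 ⟪⟫ ⟪⟫.
Qed.

Lemma cross_σhat_unit : σhat ∘ (η2 ⊗ η2) ≡ η1 ⊗ η2.
Proof.
(* The search takes both orders of the two units for sorted and never interchanges
   them. *)
have swap : σhat ∘ ((η2 ⊗ id2) ∘ η2) ≡ σhat ∘ (η2 ⊗ η2).
  by apply: (@by_moves C h [::] [:: Swap 0] [::]).
apply: (holds_trans (holds_sym swap)); apply: holds_sym.
refine (holds_trans _
  (holds_trans (in_context (post := id12) (pre := η2 ⊗ η1) cross_φ21 (erefl true)) _)).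
  diagram_with (units0 U0 ++ both cross_φ21_unitl) (associativities U0) ⟪⟫ ⟪⟫.
diagram_with (units0 U0 ++ both cross_φ21_unitl) (associativities U0) ⟪⟫ ⟪⟫.
Qed.

Let early : seq (hint h) :=
  units0 U0 ++ both cross_ε1_η1 ++ both cross_φ21_unitl ++ both cross_σhat_unit.
Tactic Notation "diagram0" constr(hl) constr(hr) :=
  diagram_with early (associativities U0) hl hr.
Tactic Notation "context0" constr(E) constr(post) constr(pre) constr(ll) constr(rl) :=
  refine (holds_trans _
    (holds_trans (in_context (post := post) (pre := pre) E (erefl true)) _));
  [diagram0 ⟪⟫ ll|diagram0 rl ⟪⟫].

Lemma cross_ε1_m1 : ε1 ∘ m1 ≡ ε1 ⊗ ε1.
Proof. context0 cross_counit_mul idI (id1 ⊗ η2 ⊗ id1 ⊗ η2) ⟪m_def⟫ ⟪⟫. Qed.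

Lemma cross_ε1_σ : ε1 ∘ σ ≡ ε2 ⊗ ε2.
Proof.
context0 cross_counit_mul idI (η1 ⊗ id2 ⊗ η1 ⊗ id2)
  ⟪m_def; φ21_def; σhat_def; α_def; β_def⟫ ⟪⟫.
Qed.

Lemma cross_σ_unitl : σ ∘ (η2 ⊗ id2) ≡ η1 ∘ ε2.
Proof.
context0 cross_unitl (id1 ⊗ ε2) (η1 ⊗ id2) ⟪m_def; σhat_def; α_def; β_def⟫ ⟪⟫.
Qed.

Lemma cross_σ_unitr : σ ∘ (id2 ⊗ η2) ≡ η1 ∘ ε2.
Proof.
context0 cross_unitr (id1 ⊗ ε2) (η1 ⊗ id2) ⟪m_def; φ21_def; σhat_def; α_def; β_def⟫ ⟪⟫.
Qed.

Lemma cross_unital : unital.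
Proof.
split=> //.
- by split; [of_holds cross_ε1_m1|of_holds cross_ε1_η1].
- by split; [of_dual cross_ε1_m1|of_dual cross_ε1_η1].
split; [of_holds cross_σ_unitl|of_holds cross_σ_unitr|of_holds cross_ε1_σ|
  of_dual cross_σ_unitl|of_dual cross_σ_unitr|of_dual cross_ε1_σ].
Qed.

Let U := cross_unital.
Tactic Notation "diagram1" constr(hl) constr(hr) :=
  diagram_with (units U) (associativities U) hl hr.

Lemma m_ε1 : (ε1 ⊗ id2) ∘ m ≡ ε1 ⊗ m2 ∘ (μr ⊗ id2).
Proof. diagram1 ⟪m_def⟫ ⟪⟫. Qed.

Lemma m_η1 : m ∘ (id12 ⊗ η1 ⊗ id2) ≡ (m1 ⊗ id2) ∘ (id1 ⊗ σhat).
Proof. diagram1 ⟪m_def⟫ ⟪⟫. Qed.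

Lemma κ_η2 : κ ∘ (id12 ⊗ id1 ⊗ η2) ≡ λ.
Proof. diagram1 ⟪κ_def⟫ ⟪λ_def⟫. Qed.

Let late : seq (hint h) := units U ++ both m_ε1 ++ both m_η1 ++ both κ_η2.
Tactic Notation "diagram" constr(hl) constr(hr) :=
  diagram_with late (associativities U) hl hr.
Tactic Notation "context" constr(E) constr(post) constr(pre)
    constr(ll) constr(rl) constr(rr) :=
  refine (holds_trans _
    (holds_trans (in_context (post := post) (pre := pre) E (erefl true)) _));
  [diagram ⟪⟫ ll|diagram rl rr].

(* projections of B1 (x) B2 to its factors, and embeddings of the factors *)
Let p1 := id1 ⊗ ε2.
Let p2 := ε1 ⊗ id2.
Let i1 := id1 ⊗ η2.
Let i2 := η1 ⊗ id2.

(** Each compatibility is a component of associativity or of multiplicativity of the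
    coproduct: the inputs are restricted to B1 or B2, the outputs projected. *)
Lemma cross_μr_assoc : μr ∘ (μr ⊗ id1) ≡ μr ∘ (id2 ⊗ m1).
Proof. context cross_assoc p2 (i2 ⊗ i1 ⊗ i1) ⟪⟫ ⟪⟫ ⟪⟫. Qed.

Lemma cross_m2_wassoc : m2 ∘ (m2 ⊗ id2) ≡ m2 ∘ (μr ⊗ id2) ∘ (id2 ⊗ σhat).
Proof. context cross_assoc p2 (i2 ⊗ i2 ⊗ i2) ⟪⟫ ⟪⟫ ⟪⟫. Qed.

Lemma cross_μl_wassoc :
  m1 ∘ (id1 ⊗ μl) ∘ (σhat ⊗ id1)
  ≡ m1 ∘ (id1 ⊗ σ) ∘ (φ21 ⊗ id2) ∘ (id2 ⊗ φ21).
Proof. context cross_assoc p1 (i2 ⊗ i2 ⊗ i1) ⟪λ_def⟫ ⟪⟫ ⟪⟫. Qed.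

Lemma cross_μl_m1 : μl ∘ (id2 ⊗ m1) ≡ m1 ∘ (id1 ⊗ μl) ∘ (φ21 ⊗ id1).
Proof. apply: holds_sym; context cross_assoc p1 (i2 ⊗ i1 ⊗ i1) ⟪λ_def⟫ ⟪⟫ ⟪⟫. Qed.

Lemma cross_μr_m2 : μr ∘ (m2 ⊗ id1) ≡ m2 ∘ (μr ⊗ id2) ∘ (id2 ⊗ φ21).
Proof. context cross_assoc p2 (i2 ⊗ i2 ⊗ i1) ⟪⟫ ⟪⟫ ⟪⟫. Qed.

Lemma cross_σ_cocycle :
  m1 ∘ (id1 ⊗ σ) ∘ (σhat ⊗ id2)
  ≡ m1 ∘ (id1 ⊗ σ) ∘ (φ21 ⊗ id2) ∘ (id2 ⊗ σhat).
Proof. context cross_assoc p1 (i2 ⊗ i2 ⊗ i2) ⟪κ_def⟫ ⟪⟫ ⟪⟫. Qed.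

Lemma cross_Δ2_μr : Δ2 ∘ μr ≡ (α ⊗ μr) ∘ (id2 ⊗ Ψ [:: L2] [:: L1; L2] ⊗ id1) ∘ (Δ2 ⊗ ζ).
Proof. context cross_comul_mul (p2 ⊗ p2) (i2 ⊗ i1) ⟪⟫ ⟪β_def⟫ ⟪ζ_def; α_def⟫. Qed.

Lemma cross_ρhat_φ21 : ρhat ∘ φ21 ≡ (κ ⊗ λ) ∘ (id12 ⊗ Θ ⊗ id1) ∘ (ω ⊗ ζ).
Proof. context cross_comul_mul (p1 ⊗ p1) (i2 ⊗ i1) ⟪⟫ ⟪⟫ ⟪ζ_def⟫. Qed.

Lemma cross_φ12_φ21 : φ12 ∘ φ21 ≡ (α ⊗ λ) ∘ (id2 ⊗ Θ ⊗ id1) ∘ (β ⊗ ζ).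
Proof. context cross_comul_mul (p2 ⊗ p1) (i2 ⊗ i1) ⟪⟫ ⟪⟫ ⟪ζ_def; α_def⟫. Qed.

Lemma cross_ρhat_σhat : ρhat ∘ σhat ≡ (κ ⊗ κ) ∘ (id12 ⊗ Θ ⊗ id12) ∘ (ω ⊗ ω).
Proof. context cross_comul_mul (p1 ⊗ p1) (i2 ⊗ i2) ⟪⟫ ⟪⟫ ⟪⟫. Qed.

(** In this component the product κ still contains a σ, which (S5) removes. *)
Lemma cross_Δ1_m1 : Δ1 ∘ m1 ≡ (λ ⊗ m1) ∘ (id12 ⊗ Ψ11 ⊗ id1) ∘ (ζ ⊗ Δ1).
Proof.
context cross_comul_mul (p1 ⊗ p1) (i1 ⊗ i1)
  ⟪⟫ ⟪κ_def; S5_past KS (w := [:: L1]) isT; λ_def⟫ ⟪ζ_def; λ_def⟫.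
Qed.

Lemma bowtie_converse : strong_hopf_datum h.
Proof.
split; last exact: KS.
split.
- exact: cpa_algebra1 KA.
- exact: u_augmentation U.
- exact: cpc_coalgebra2 KD.
- exact: u_coaugmentation U.
- by split; [of_dual (holds_sym cross_μr_assoc)|exact: Defs.νl_ε2 (u_U3 U)].
- by split; [of_holds cross_μr_assoc|exact: Defs.μr_η1 (u_U3 U)].
- exact: ccp_U1 KC.
- exact: ccp_U2 KC.
- exact: u_σρ U.
split.
- of_holds cross_m2_wassoc.
- of_dual cross_m2_wassoc.
- of_holds cross_μl_wassoc.
- of_dual cross_μl_wassoc.
- of_holds cross_μl_m1.
- of_holds cross_μr_m2.
- of_dual cross_μr_m2.
- of_dual cross_μl_m1.
- of_holds cross_σ_cocycle.
- of_dual cross_σ_cocycle.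
- of_holds cross_Δ1_m1.
- of_dual cross_Δ1_m1.
- of_holds cross_ρhat_φ21.
- of_holds cross_Δ2_μr.
- of_dual cross_Δ2_μr.
- of_dual cross_ρhat_φ21.
- of_holds cross_φ12_φ21.
- of_holds cross_ρhat_σhat.
Qed.
End Converse.

End Theory.

(** * The correspondence *)

(** All components of a cocycle cross product bialgebra besides its structure
    morphisms are prescribed by formulas in these. *)
Lemma bowtie_structure (C : strict_braided_category) (X : cross_product_data C) :
  strong_cross_product_bialgebra X -> bowtie X = X.
Proof.
case: X => h f12 f21 s r m η Δ ε K; have KC := scp_cocycle K.
have KA := cpb_algebra (ccp_bialgebra KC); have KD := cpb_coalgebra (ccp_bialgebra KC).
move: (ccp_φ12 KC) (ccp_φ21 KC) (ccp_σhat KC) (ccp_ρhat KC).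
move: (cpa_mul KA) (cpa_unit KA) (cpc_comul KD) (cpc_counit KD) => /= {KC KA KD K}.
by move=> -> -> -> -> -> -> -> ->.
Qed.

Theorem theorem4p4 (C : strict_braided_category) (splitC : idempotents_split C) :
  (forall h : structure_data C,
     strong_hopf_datum h -> strong_cross_product_bialgebra (bowtie h)) /\
  (forall X : cross_product_data C,
     strong_cross_product_bialgebra X -> strong_hopf_datum (cp_structure X)) /\
  (forall h : structure_data C,
     strong_hopf_datum h -> cp_structure (bowtie h) = h) /\
  (forall X : cross_product_data C,
     strong_cross_product_bialgebra X -> bowtie (cp_structure X) = X).
Proof.
split; first exact: bowtie_strong.
split; last by split=> //; exact: bowtie_structure.
by move=> X K; apply: bowtie_converse; rewrite bowtie_structure.
Qed.
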